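(* Let $\phi\colon\mathbb{D}\to\mathbb{D}$ be an analytic self-map and $0<p<\infty$. If there exists $w\in H^2$, $w\not\equiv0$, such that $M_wC_\phi\colon f\mapsto w\,(f\circ\phi)$ is a bounded operator on $H^2$ belonging to $S_p(H^2)$, then there exists $\tilde w\in H^2$, $\tilde w\not\equiv0$, such that $M_{\tilde w}C_\phi$ is a Hilbert–Schmidt operator on $H^2$.
   Context: $\mathbb{D}$ is the open unit disk, $H^2$ the Hardy space. $S_p(H^2)$, $p>0$, is the Schatten class of compact operators $T$ on $H^2$ with $\sum_n s_n(T)^p<\infty$ ($s_n$ the singular numbers). *)

(* Defs.v *)
From Stdlib Require Import Reals.
From Coquelicot Require Import Coquelicot.
Open Scope R_scope.

Definition inD (z : C) : Prop := Cmod z < 1.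

Definition is_pseries_on_D (a : nat -> C) (f : C -> C) : Prop :=
  forall z : C, inD z -> is_series (fun n => (a n * Cpow z n)%C) (f z).

Definition l2sum (a : nat -> C) : R := Series (fun n => Cmod (a n) ^ 2).

(* a is the (Taylor) coefficient sequence of f and is square summable,
   i.e. f in H^2 with ||f||^2 = l2sum a *)
Definition is_H2_coeffs (a : nat -> C) (f : C -> C) : Prop :=
  ex_series (fun n => Cmod (a n) ^ 2) /\ is_pseries_on_D a f.

Definition H2 (f : C -> C) : Prop := exists a, is_H2_coeffs a f.

(* analytic self-map of the disk: holomorphic on D (= power series at 0
   converging on D) with values in D *)
Definition analytic_selfmap (phi : C -> C) : Prop :=
  (exists c : nat -> C, is_pseries_on_D c phi) /\
  (forall z, inD z -> inD (phi z)).

(* operators act on functions C -> C; only values on D matter *)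
Definition op := (C -> C) -> (C -> C).

Definition MwCphi (w phi : C -> C) : op := fun f z => (w z * f (phi z))%C.

Definition linear_H2 (T : op) : Prop :=
  (forall f g, H2 f -> H2 g -> forall z, inD z -> T (fun x => f x + g x)%C z = (T f z + T g z)%C) /\
  (forall (c : C) f, H2 f -> forall z, inD z -> T (fun x => c * f x)%C z = (c * T f z)%C).

Definition bounded_H2 (T : op) : Prop :=
  exists M : R, forall a f, is_H2_coeffs a f ->
    exists b, is_H2_coeffs b (T f) /\ l2sum b <= M ^ 2 * l2sum a.

Fixpoint lincomb (lam : nat -> C) (g : nat -> C -> C) (n : nat) (z : C) : C :=
  match n with
  | O => 0%C
  | S k => (lincomb lam g k z + lam k * g k z)%C
  end.

Definition rank_le_H2 (F : op) (n : nat) : Prop :=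
  linear_H2 F /\ bounded_H2 F /\
  exists g : nat -> C -> C, (forall i, (i < n)%nat -> H2 (g i)) /\
    forall f, H2 f -> exists lam : nat -> C,
      forall z, inD z -> F f z = lincomb lam g n z.

Definition opnorm_diff_le (T F : op) (e : R) : Prop :=
  forall a f b c, is_H2_coeffs a f -> is_H2_coeffs b (T f) -> is_H2_coeffs c (F f) ->
    l2sum (fun k => (b k - c k)%C) <= e ^ 2 * l2sum a.

(* n-th singular number (approximation number, n starting at 0):
   s_n(T) = inf { ||T - F|| : rank F <= n } *)
Definition sing_num (T : op) (n : nat) : R :=
  real (Glb_Rbar (fun e => 0 <= e /\ exists F, rank_le_H2 F n /\ opnorm_diff_le T F e)).

Definition rpow (x p : R) : R := if Rle_dec x 0 then 0 else Rpower x p.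

(* Schatten class S_p(H^2): bounded linear, sum_n s_n(T)^p < oo
   (this forces s_n -> 0, i.e. compactness) *)
Definition Schatten (p : R) (T : op) : Prop :=
  linear_H2 T /\ bounded_H2 T /\ ex_series (fun n => rpow (sing_num T n) p).

Definition HilbertSchmidt (T : op) : Prop := Schatten 2 T.

(* Main.v *)
Require Import Defs.
From Stdlib Require Import Reals Lra Lia FunctionalExtensionality ClassicalEpsilon.
From Coquelicot Require Import Coquelicot.
Open Scope R_scope.

(** Let [T = M_w C_phi] be in the Schatten class.  Its approximation numbers decay
    polynomially along a subsequence, and since an operator of rank [n] has squared
    Hilbert-Schmidt norm at most [n] times its squared norm, for every [k] some
    [w phi^j] with [j < 4^k] has squared norm at most [C s^(2k)], where [s < 1].  Hence
    [U = sum_k s^(-k) |w phi^(j_k)|^2] is integrable on the circle.  If [F] is analytic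
    with [Re F = 1 + U] on the circle, then [h = 1/F] is analytic and [g = h w] satisfies
    [|g|^2 |phi|^(2 * 4^k) <= s^k] in the disk.  A large power [wt] of [g] therefore
    satisfies [|wt|^2 |phi|^(2n) / (1 - |phi|^2) <= C / (n+1)^2], which bounds the distance
    from [M_wt C_phi] to its truncation of rank [n] and makes it Hilbert-Schmidt.

    No boundary values are used: [F] and [h] are formal power series, the inequality
    between [Re F] and [1 + U] is one between Toeplitz forms, and pointwise bounds in the
    disk are turned into norm bounds by averaging over roots of unity. *)

(** * Finite sums of complex and real numbers *)

(** For large [p] the singular numbers may decay like a small negative power of [n], too slowly for
    [w] itself to serve as the new weight. Decay of norms cannot be sped up, but pointwise decay
    can, by taking powers; hence the need to turn infinitely many norm bounds into pointwise ones
    with a single multiplier [h]. Heuristically, on the circle [|F| >= Re F = 1 + U], so [|h|^2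
    s^(-k) |w phi^(j_k)|^2 <= U / (1 + U)^2 <= 1] for every [k] simultaneously, and the summand 1
    keeps [h] bounded. The scale [4^k] is a balance: an approximant of rank below [2^k] has squared
    Hilbert-Schmidt norm of order [2^k], and averaging it over [4^k] monomials leaves [2^(-k)]. The
    power of [g] is [2m] with [s^m <= 1/16]: with [G = |g|^2], one copy of [G^m] pays for the factor
    [(n+1)^2] and the other for [1 / (1 - |phi|^2)]. *)

Fixpoint csum (f : nat -> C) (n : nat) : C :=
  match n with O => 0%C | S k => (csum f k + f k)%C end.

Fixpoint rsum (f : nat -> R) (n : nat) : R :=
  match n with O => 0 | S k => rsum f k + f k end.

Lemma csum_ext (f g : nat -> C) n :
  (forall i, (i < n)%nat -> f i = g i) -> csum f n = csum g n.
Proof.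
  induction n as [|n IH]; intros H; simpl; [easy|].
  rewrite IH, H by (intros; try apply H; lia); easy.
Qed.

Lemma rsum_ext (f g : nat -> R) n :
  (forall i, (i < n)%nat -> f i = g i) -> rsum f n = rsum g n.
Proof.
  induction n as [|n IH]; intros H; simpl; [easy|].
  rewrite IH, H by (intros; try apply H; lia); easy.
Qed.

Lemma csum_plus (f g : nat -> C) n :
  csum (fun i => (f i + g i)%C) n = (csum f n + csum g n)%C.
Proof. induction n as [|n IH]; simpl; [|rewrite IH]; ring. Qed.

Lemma rsum_plus (f g : nat -> R) n :
  rsum (fun i => f i + g i) n = rsum f n + rsum g n.
Proof. induction n as [|n IH]; simpl; [|rewrite IH]; ring. Qed.

Lemma csum_scal c f n : csum (fun i => (c * f i)%C) n = (c * csum f n)%C.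
Proof. induction n as [|n IH]; simpl; [|rewrite IH]; ring. Qed.

Lemma csum_scal_r c f n : csum (fun i => (f i * c)%C) n = (csum f n * c)%C.
Proof. induction n as [|n IH]; simpl; [|rewrite IH]; ring. Qed.

Lemma rsum_scal c f n : rsum (fun i => c * f i) n = c * rsum f n.
Proof. induction n as [|n IH]; simpl; [|rewrite IH]; ring. Qed.

Lemma csum_minus (f g : nat -> C) n :
  csum (fun i => (f i - g i)%C) n = (csum f n - csum g n)%C.
Proof. induction n as [|n IH]; simpl; [|rewrite IH]; ring. Qed.

Lemma csum_0 (f : nat -> C) n : (forall i, (i < n)%nat -> f i = 0%C) -> csum f n = 0%C.
Proof.
  induction n as [|n IH]; intros H; simpl; [easy|].
  rewrite IH, H by (intros; try apply H; lia); ring.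
Qed.

Lemma rsum_const c n : rsum (fun _ => c) n = INR n * c.
Proof.
  induction n as [|n IH]; [simpl; ring|].
  rewrite S_INR. cbn [rsum]. rewrite IH. ring.
Qed.

Lemma csum_const c n : csum (fun _ => c) n = (RtoC (INR n) * c)%C.
Proof.
  induction n as [|n IH]; [simpl; ring|].
  rewrite S_INR, RtoC_plus. cbn [csum]. rewrite IH. ring.
Qed.

Lemma rsum_le (f g : nat -> R) n :
  (forall i, (i < n)%nat -> f i <= g i) -> rsum f n <= rsum g n.
Proof.
  induction n as [|n IH]; intros H; simpl; [lra|].
  apply Rplus_le_compat; [apply IH; intros; apply H; lia | apply H; lia].
Qed.

Lemma rsum_nonneg (f : nat -> R) n : (forall i, (i < n)%nat -> 0 <= f i) -> 0 <= rsum f n.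
Proof.
  intros H. replace 0 with (rsum (fun _ => 0) n).
  - now apply rsum_le.
  - rewrite rsum_const. ring.
Qed.

Lemma rsum_incr (f : nat -> R) n m :
  (forall i, 0 <= f i) -> (n <= m)%nat -> rsum f n <= rsum f m.
Proof.
  intros H Hnm. induction Hnm as [|m Hnm IH]; simpl; [lra|].
  specialize (H m). lra.
Qed.

Lemma rsum_ge_term (f : nat -> R) n i :
  (forall j, 0 <= f j) -> (i < n)%nat -> f i <= rsum f n.
Proof.
  intros H Hi. apply Rle_trans with (rsum f (S i)).
  - simpl. assert (0 <= rsum f i) by now apply rsum_nonneg. lra.
  - apply rsum_incr; [easy|lia].
Qed.

Lemma rsum_pigeonhole (f : nat -> R) n B :
  (0 < n)%nat -> rsum f n <= B -> exists i, (i < n)%nat /\ f i <= B / INR n.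
Proof.
  intros Hn HB. assert (Hn' : 0 < INR n) by now apply lt_0_INR.
  apply NNPP. intros Hno.
  assert (H : forall m, (m <= n)%nat -> (0 < m)%nat -> rsum f m > INR m * (B / INR n)).
  { induction m as [|m IH]; intros Hm Hm0; [lia|].
    assert (f m > B / INR n).
    { apply Rnot_le_gt. intros Hle. apply Hno. exists m. split; [lia|easy]. }
    rewrite S_INR. cbn [rsum]. destruct m as [|m].
    - simpl in *. lra.
    - specialize (IH ltac:(lia) ltac:(lia)). lra. }
  specialize (H n (le_n n) Hn).
  replace (INR n * (B / INR n)) with B in H by (field; lra). lra.
Qed.

Lemma csum_switch (f : nat -> nat -> C) n m :
  csum (fun i => csum (fun j => f i j) m) n = csum (fun j => csum (fun i => f i j) n) m.
Proof.
  induction n as [|n IH]; simpl.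
  - symmetry. now apply csum_0.
  - now rewrite IH, csum_plus.
Qed.

Lemma rsum_switch (f : nat -> nat -> R) n m :
  rsum (fun i => rsum (fun j => f i j) m) n = rsum (fun j => rsum (fun i => f i j) n) m.
Proof.
  induction n as [|n IH]; simpl.
  - rewrite rsum_const. ring.
  - now rewrite IH, rsum_plus.
Qed.

Lemma csum_split (f : nat -> C) n m :
  csum f (n + m) = (csum f n + csum (fun i => f (n + i)%nat) m)%C.
Proof.
  induction m as [|m IH]; simpl; [rewrite Nat.add_0_r; ring|].
  rewrite Nat.add_succ_r. simpl. rewrite IH. ring.
Qed.

Lemma rsum_split (f : nat -> R) n m :
  rsum f (n + m) = rsum f n + rsum (fun i => f (n + i)%nat) m.
Proof.
  induction m as [|m IH]; simpl; [rewrite Nat.add_0_r; ring|].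
  rewrite Nat.add_succ_r. simpl. rewrite IH. ring.
Qed.

Lemma csum_first (f : nat -> C) n : csum f (S n) = (f 0%nat + csum (fun i => f (S i)) n)%C.
Proof. change (S n) with (1 + n)%nat. rewrite csum_split. simpl. ring. Qed.

Lemma csum_single (f : nat -> C) n k :
  (k < n)%nat -> (forall i, (i < n)%nat -> i <> k -> f i = 0%C) -> csum f n = f k.
Proof.
  intros Hk H. replace n with (k + S (n - S k))%nat by lia.
  rewrite csum_split, csum_first, Nat.add_0_r.
  rewrite !csum_0; [ring| |]; intros; apply H; lia.
Qed.

(** The triangle [i <= j <= n] is summed by columns, with [l = j - i]. This one exchange gives both
    the associativity of convolution and the formula for partial sums of a Cauchy product. *)
Lemma csum_triangle (f : nat -> nat -> C) n :
  csum (fun j => csum (fun i => f j i) (S j)) (S n) =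
  csum (fun i => csum (fun l => f (i + l)%nat i) (S (n - i))) (S n).
Proof.
  induction n as [|n IH]; [easy|].
  set (L := csum (fun j => csum (fun i => f j i) (S j)) (S n)) in *.
  change (csum (fun j => csum (fun i => f j i) (S j)) (S (S n)))
    with (L + csum (fun i => f (S n) i) (S (S n)))%C.
  rewrite IH. clear L IH.
  set (g := fun i => csum (fun l => f (i + l)%nat i) (S (S n - i))).
  change (csum g (S (S n))) with (csum g (S n) + g (S n))%C.
  change (csum (fun i => f (S n) i) (S (S n)))
    with (csum (fun i => f (S n) i) (S n) + f (S n) (S n))%C.
  replace (g (S n)) with (f (S n) (S n)).
  2:{ unfold g. rewrite Nat.sub_diag. simpl. rewrite Nat.add_0_r. ring. }
  rewrite Cplus_assoc, <- csum_plus. f_equal.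
  apply csum_ext. intros i Hi. unfold g.
  replace (S n - i)%nat with (S (n - i)) by lia.
  replace (f (S n) i) with (f (i + S (n - i))%nat i) by (f_equal; lia).
  easy.
Qed.

Lemma Re_csum (f : nat -> C) n : Re (csum f n) = rsum (fun i => Re (f i)) n.
Proof. induction n as [|n IH]; [easy|]. cbn [csum rsum]. now rewrite re_plus, IH. Qed.

Lemma Cconj_csum (f : nat -> C) n : Cconj (csum f n) = csum (fun i => Cconj (f i)) n.
Proof.
  induction n as [|n IH]; cbn [csum]; [|now rewrite Cplus_conj, IH].
  unfold Cconj. simpl. now rewrite Ropp_0.
Qed.

Lemma RtoC_rsum (f : nat -> R) n : RtoC (rsum f n) = csum (fun i => RtoC (f i)) n.
Proof. induction n as [|n IH]; [easy|]. cbn [csum rsum]. now rewrite RtoC_plus, IH. Qed.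

Lemma Cmod_csum_le (f : nat -> C) n : Cmod (csum f n) <= rsum (fun i => Cmod (f i)) n.
Proof.
  induction n as [|n IH]; simpl; [rewrite Cmod_0; lra|].
  eapply Rle_trans; [apply Cmod_triangle|lra].
Qed.

Lemma Cmod2_nonneg z : 0 <= Cmod z ^ 2.
Proof. apply pow2_ge_0. Qed.

Lemma Cmod2_mult a b : Cmod (a * b)%C ^ 2 = Cmod a ^ 2 * Cmod b ^ 2.
Proof. rewrite Cmod_mult. ring. Qed.

Lemma Cmod2_plus_le a b : Cmod (a + b)%C ^ 2 <= 2 * Cmod a ^ 2 + 2 * Cmod b ^ 2.
Proof.
  rewrite !Cmod2_alt, re_plus, im_plus.
  assert (0 <= (Re a - Re b) ^ 2 + (Im a - Im b) ^ 2)
    by (apply Rplus_le_le_0_compat; apply pow2_ge_0).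
  nra.
Qed.

Lemma Cmod2_eq_0 z : Cmod z ^ 2 <= 0 -> z = 0%C.
Proof. intros H. apply Cmod_eq_0. assert (H1 := Cmod_ge_0 z). apply Rle_antisym; nra. Qed.

Lemma Rmult_le_AMGM x y : x * y <= (x ^ 2 + y ^ 2) / 2.
Proof. assert (0 <= (x - y) ^ 2) by apply pow2_ge_0. nra. Qed.

Lemma rsum_Cauchy_Schwarz x y n :
  rsum (fun i => x i * y i) n ^ 2
  <= rsum (fun i => x i ^ 2) n * rsum (fun i => y i ^ 2) n.
Proof.
  induction n as [|n IH]; cbn [rsum]; [lra|].
  set (P := rsum (fun i => x i * y i) n) in *.
  set (X := rsum (fun i => x i ^ 2) n) in *.
  set (Y := rsum (fun i => y i ^ 2) n) in *.
  assert (HX : 0 <= X) by (apply rsum_nonneg; intros; apply pow2_ge_0).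
  assert (HY : 0 <= Y) by (apply rsum_nonneg; intros; apply pow2_ge_0).
  clearbody P X Y.
  (* The cross term of the induction step: its square is at most [4 X Y (x n * y n)^2] by the
     induction hypothesis, and this is at most the square of the right side by AM-GM. *)
  assert (H : 2 * P * (x n * y n) <= X * y n ^ 2 + Y * x n ^ 2).
  { apply Rsqr_incr_0_var; [|apply Rplus_le_le_0_compat; apply Rmult_le_pos; nra].
    unfold Rsqr.
    assert (P ^ 2 * (x n * y n) ^ 2 <= X * Y * (x n * y n) ^ 2)
      by (apply Rmult_le_compat_r; [apply pow2_ge_0|easy]).
    assert (0 <= (X * y n ^ 2 - Y * x n ^ 2) ^ 2) by apply pow2_ge_0. lra. }
  lra.
Qed.

Lemma csum_Cauchy_Schwarz u v n :
  Cmod (csum (fun i => (u i * v i)%C) n) ^ 2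
  <= rsum (fun i => Cmod (u i) ^ 2) n * rsum (fun i => Cmod (v i) ^ 2) n.
Proof.
  eapply Rle_trans; [|apply rsum_Cauchy_Schwarz].
  apply pow_incr. split; [apply Cmod_ge_0|].
  eapply Rle_trans; [apply Cmod_csum_le|].
  apply rsum_le. intros. rewrite Cmod_mult. lra.
Qed.

Lemma rsum_geom x n : x <> 1 -> rsum (fun i => x ^ i) n = (1 - x ^ n) / (1 - x).
Proof.
  intros Hx. induction n as [|n IH]; simpl; [field; lra|].
  rewrite IH. field. lra.
Qed.

Lemma rsum_geom_le x n : 0 <= x < 1 -> rsum (fun i => x ^ i) n <= / (1 - x).
Proof.
  intros Hx. rewrite rsum_geom by lra. unfold Rdiv.
  assert (0 <= x ^ n) by (apply pow_le; lra).
  assert (0 < / (1 - x)) by (apply Rinv_0_lt_compat; lra). nra.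
Qed.

(** * Convergence of complex sequences and series *)

(** Convergence in C is encoded as a real limit of moduli, so that squeezing and order arguments for
    real sequences apply directly. *)
Definition Ccv (u : nat -> C) (l : C) : Prop :=
  is_lim_seq (fun n => Cmod (u n - l)%C) 0.

Lemma Ccv_squeeze u l e :
  (forall n, Cmod (u n - l)%C <= e n) -> is_lim_seq e 0 -> Ccv u l.
Proof.
  intros H He. apply is_lim_seq_le_le with (fun _ => 0) e; [|apply is_lim_seq_const|easy].
  intros n. split; [apply Cmod_ge_0|apply H].
Qed.

Lemma Ccv_ext u v l : (forall n, u n = v n) -> Ccv u l -> Ccv v l.
Proof. intros H. apply is_lim_seq_ext. intros n. now rewrite H. Qed.

Lemma Ccv_const l : Ccv (fun _ => l) l.
Proof.
  apply Ccv_squeeze with (fun _ => 0); [|apply is_lim_seq_const].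
  intros _. replace (l - l)%C with (0 : C) by ring. rewrite Cmod_0. lra.
Qed.

Lemma Ccv_plus u v l m : Ccv u l -> Ccv v m -> Ccv (fun n => (u n + v n)%C) (l + m)%C.
Proof.
  intros Hu Hv.
  apply Ccv_squeeze with (fun n => Cmod (u n - l)%C + Cmod (v n - m)%C).
  - intros n. replace (u n + v n - (l + m))%C with ((u n - l) + (v n - m))%C by ring.
    apply Cmod_triangle.
  - replace (Finite 0) with (Finite (0 + 0)) by (f_equal; ring).
    now apply is_lim_seq_plus'.
Qed.

Lemma Ccv_scal c u l : Ccv u l -> Ccv (fun n => (c * u n)%C) (c * l)%C.
Proof.
  intros Hu. apply Ccv_squeeze with (fun n => Cmod c * Cmod (u n - l)%C).
  - intros n. rewrite <- Cmod_mult. right. f_equal. ring.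
  - replace (Finite 0) with (Rbar_mult (Cmod c) 0) by (simpl; f_equal; ring).
    now apply is_lim_seq_scal_l.
Qed.

Lemma Ccv_Cmod u l : Ccv u l -> is_lim_seq (fun n => Cmod (u n)) (Cmod l).
Proof.
  intros H.
  apply is_lim_seq_le_le with (fun n => Cmod l - Cmod (u n - l)%C)
    (fun n => Cmod l + Cmod (u n - l)%C).
  - intros n. split.
    + assert (H1 := Cmod_triangle (u n) (- (u n - l))%C). rewrite Cmod_opp in H1.
      replace (u n + - (u n - l))%C with l in H1 by ring. lra.
    + assert (H1 := Cmod_triangle l (u n - l)%C).
      now replace (l + (u n - l))%C with (u n) in H1 by ring.
  - replace (Finite (Cmod l)) with (Finite (Cmod l - 0)) by (f_equal; ring).
    apply is_lim_seq_minus'; [apply is_lim_seq_const|easy].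
  - replace (Finite (Cmod l)) with (Finite (Cmod l + 0)) by (f_equal; ring).
    apply is_lim_seq_plus'; [apply is_lim_seq_const|easy].
Qed.

Lemma Ccv_Re u l : Ccv u l -> is_lim_seq (fun n => Re (u n)) (Re l).
Proof.
  intros H.
  apply is_lim_seq_le_le with (fun n => Re l - Cmod (u n - l)%C)
    (fun n => Re l + Cmod (u n - l)%C).
  - intros n. assert (H1 := re_le_Cmod (u n - l)%C).
    unfold Cminus in H1 at 1. rewrite re_plus, re_opp in H1.
    apply Rabs_le_between in H1. lra.
  - replace (Finite (Re l)) with (Finite (Re l - 0)) by (f_equal; ring).
    apply is_lim_seq_minus'; [apply is_lim_seq_const|easy].
  - replace (Finite (Re l)) with (Finite (Re l + 0)) by (f_equal; ring).
    apply is_lim_seq_plus'; [apply is_lim_seq_const|easy].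
Qed.

Lemma is_lim_seq_le_const u l c :
  is_lim_seq u (Finite l) -> (forall n, u n <= c) -> l <= c.
Proof.
  intros Hu H. now apply (is_lim_seq_le u (fun _ => c) l c) in H;
    [|easy|apply is_lim_seq_const].
Qed.

Lemma is_lim_seq_ge_const u l c :
  is_lim_seq u (Finite l) -> (forall n, c <= u n) -> c <= l.
Proof.
  intros Hu H. now apply (is_lim_seq_le (fun _ => c) u c l) in H;
    [|apply is_lim_seq_const|easy].
Qed.

Lemma Ccv_Cmod_le u l c : Ccv u l -> (forall n, Cmod (u n) <= c) -> Cmod l <= c.
Proof. intros Hu. apply is_lim_seq_le_const. now apply Ccv_Cmod. Qed.

Lemma Ccv_unique u l m : Ccv u l -> Ccv u m -> l = m.
Proof.
  intros Hl Hm.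
  assert (H : Ccv (fun n => (u n + (-(1)) * u n)%C) (l + (-(1)) * m)%C).
  { apply Ccv_plus; [easy|]. now apply Ccv_scal. }
  apply Ccv_Cmod_le with (c := 0) in H.
  - assert (l + (-(1)) * m = 0)%C.
    { apply Cmod_eq_0. assert (H1 := Cmod_ge_0 (l + (-(1)) * m)%C). lra. }
    replace l with (m + (l + (-(1)) * m))%C by ring. rewrite H0. ring.
  - intros n. replace (u n + - (1) * u n)%C with (0 : C) by ring. rewrite Cmod_0. lra.
Qed.

Lemma Ccv_shift u l k : Ccv u l -> Ccv (fun n => u (n + k)%nat) l.
Proof. intros H. now apply (is_lim_seq_incr_n (fun n => Cmod (u n - l)%C)). Qed.

Lemma Ccv_mult u v l m : Ccv u l -> Ccv v m -> Ccv (fun n => (u n * v n)%C) (l * m)%C.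
Proof.
  intros Hu Hv.
  apply Ccv_squeeze
    with (fun n => Cmod (u n - l)%C * Cmod (v n) + Cmod l * Cmod (v n - m)%C).
  - intros n.
    replace (u n * v n - l * m)%C with ((u n - l) * v n + l * (v n - m))%C by ring.
    rewrite <- !Cmod_mult. apply Cmod_triangle.
  - replace (Finite 0) with (Finite (0 * Cmod m + Cmod l * 0)) by (f_equal; ring).
    apply is_lim_seq_plus'; apply is_lim_seq_mult'; try easy.
    + now apply Ccv_Cmod.
    + apply is_lim_seq_const.
Qed.

Lemma sum_n_csum (f : nat -> C) n : sum_n f n = csum f (S n).
Proof.
  induction n as [|n IH].
  - rewrite sum_O. simpl. ring.
  - rewrite sum_Sn, IH. easy.
Qed.

Lemma sum_n_rsum (f : nat -> R) n : sum_n f n = rsum f (S n).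
Proof.
  induction n as [|n IH].
  - rewrite sum_O. simpl. ring.
  - rewrite sum_Sn, IH. easy.
Qed.

Lemma is_series_Ccv (f : nat -> C) (l : C) : is_series f l <-> Ccv (csum f) l.
Proof.
  assert (E : Ccv (csum f) l <-> Ccv (fun n => sum_n f n) l).
  { unfold Ccv. rewrite is_lim_seq_incr_1.
    split; apply is_lim_seq_ext; intros n; now rewrite sum_n_csum. }
  rewrite E. unfold is_series, Ccv. split; intros H.
  - apply is_lim_seq_spec. intros eps.
    assert (He : 0 < eps / 2) by (destruct eps as [e He]; simpl; lra).
    destruct (H _ (locally_ball (T := C_NormedModule) l (mkposreal _ He))) as [N HN].
    exists N. intros n Hn. specialize (HN n Hn).
    apply C_NormedModule_mixin_compat2 in HN. simpl in HN.
    rewrite Rminus_0_r, Rabs_pos_eq by apply Cmod_ge_0.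
    (* Balls of C are those of the product structure, i.e. squares; passing to the modulus costs a
       factor [sqrt 2], which the choice of [eps / 2] absorbs. *)
    assert (sqrt 2 < 2).
    { rewrite <- (sqrt_Rsqr 2) at 2 by lra. apply sqrt_lt_1; unfold Rsqr; lra. }
    change (Cmod (sum_n f n - l)%C < sqrt 2 * (eps / 2)) in HN.
    nra.
  - apply is_lim_seq_spec in H. intros P [eps HP]. destruct (H eps) as [N HN].
    exists N. intros n Hn. apply HP. apply C_NormedModule_mixin_compat1.
    specialize (HN n Hn). rewrite Rminus_0_r, Rabs_pos_eq in HN by apply Cmod_ge_0.
    easy.
Qed.

Lemma is_series_rsum (f : nat -> R) (l : R) : is_series f l <-> is_lim_seq (rsum f) l.
Proof.
  rewrite is_lim_seq_incr_1. split; intros H.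
  - apply is_lim_seq_ext with (sum_n f); [intros; apply sum_n_rsum|easy].
  - change (is_lim_seq (sum_n f) l).
    apply is_lim_seq_ext with (fun n => rsum f (S n)); [|easy].
    intros; now rewrite sum_n_rsum.
Qed.

Lemma rsum_le_Series (f : nat -> R) n : (forall i, 0 <= f i) -> ex_series f -> rsum f n <= Series f.
Proof.
  intros Hf Hex. apply Series_correct in Hex. apply is_series_rsum in Hex.
  apply (is_lim_seq_incr_compare _ _ Hex). intros k. simpl. specialize (Hf k). lra.
Qed.

Lemma rsum_bounded_ex_series (f : nat -> R) B :
  (forall i, 0 <= f i) -> (forall n, rsum f n <= B) -> ex_series f.
Proof.
  intros Hf HB. destruct (ex_finite_lim_seq_incr (rsum f) B) as [l Hl].
  - intros n. simpl. specialize (Hf n). lra.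
  - easy.
  - exists l. now apply is_series_rsum.
Qed.

Lemma Series_le_rsum f B : ex_series f -> (forall n, rsum f n <= B) -> Series f <= B.
Proof.
  intros Hex. apply is_lim_seq_le_const.
  apply is_series_rsum. now apply Series_correct.
Qed.

Lemma csum_abs_cv (f : nat -> C) b B :
  (forall i, Cmod (f i) <= b i) -> (forall n, rsum b n <= B) ->
  exists l, Ccv (csum f) l.
Proof.
  intros Hf HB.
  assert (Hb : ex_series b).
  { apply rsum_bounded_ex_series with B; [|easy].
    intros i. eapply Rle_trans; [apply Cmod_ge_0|apply Hf]. }
  destruct (ex_series_le (K := C_AbsRing) (V := C_CompleteNormedModule) f b) as [l Hl]; [|easy|].
  - intros n. change (Cmod (f n) <= b n). apply Hf.
  - exists l. now apply is_series_Ccv.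
Qed.

Lemma csum_cv_le (f : nat -> C) b B l :
  (forall i, Cmod (f i) <= b i) -> (forall n, rsum b n <= B) ->
  Ccv (csum f) l -> Cmod l <= B.
Proof.
  intros Hf HB Hl. apply Ccv_Cmod_le with (1 := Hl). intros n.
  eapply Rle_trans; [apply Cmod_csum_le|].
  eapply Rle_trans; [apply rsum_le; intros; apply Hf|apply HB].
Qed.

Lemma Ccv_csum (u : nat -> nat -> C) l n :
  (forall j, (j < n)%nat -> Ccv (fun k => u k j) (l j)) ->
  Ccv (fun k => csum (u k) n) (csum l n).
Proof.
  induction n as [|n IH]; intros H; simpl.
  - apply Ccv_const.
  - apply Ccv_plus; [apply IH; intros|]; apply H; lia.
Qed.

Lemma is_lim_seq_rsum (u : nat -> nat -> R) l n :
  (forall j, (j < n)%nat -> is_lim_seq (fun k => u k j) (Finite (l j))) ->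
  is_lim_seq (fun k => rsum (u k) n) (rsum l n).
Proof.
  induction n as [|n IH]; intros H; simpl.
  - apply is_lim_seq_const.
  - apply is_lim_seq_plus'; [apply IH; intros|]; apply H; lia.
Qed.

(** * Power series on the disk *)

Definition conv (a b : nat -> C) (n : nat) : C :=
  csum (fun j => (a (n - j)%nat * b j)%C) (S n).

Definition cdelta (k n : nat) : C := if Nat.eqb n k then 1%C else 0%C.

Lemma conv_assoc a b c n : conv a (conv b c) n = conv (conv a b) c n.
Proof.
  unfold conv at 1 2.
  rewrite (csum_ext _ (fun j => csum (fun i => a (n - j)%nat * (b (j - i)%nat * c i))%C (S j)))
    by (intros; now rewrite csum_scal).
  rewrite csum_triangle.
  unfold conv. apply csum_ext. intros i Hi.
  rewrite <- csum_scal_r. apply csum_ext. intros l Hl.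
  replace (i + l - i)%nat with l by lia.
  replace (n - (i + l))%nat with (n - i - l)%nat by lia. ring.
Qed.

Lemma conv_ext a a' b b' n :
  (forall i, a i = a' i) -> (forall i, b i = b' i) -> conv a b n = conv a' b' n.
Proof. intros Ha Hb. apply csum_ext. intros. now rewrite Ha, Hb. Qed.

Lemma conv_delta_l x n : conv (cdelta 0) x n = x n.
Proof.
  unfold conv. rewrite (csum_single _ _ n).
  - rewrite Nat.sub_diag. unfold cdelta. simpl. ring.
  - lia.
  - intros i Hi Hn. unfold cdelta.
    replace (n - i =? 0)%nat with false by (symmetry; apply Nat.eqb_neq; lia). ring.
Qed.

Lemma csum_conv a b n :
  csum (conv a b) n = csum (fun i => (b i * csum a (n - i))%C) n.
Proof.
  destruct n as [|n]; [easy|]. unfold conv. rewrite csum_triangle.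
  apply csum_ext. intros i Hi. rewrite <- csum_scal.
  replace (S n - i)%nat with (S (n - i)) by lia.
  apply csum_ext. intros l Hl. replace (i + l - i)%nat with l by lia. ring.
Qed.

Lemma filterlim_half : filterlim (fun n => (n / 2)%nat) eventually eventually.
Proof.
  intros P [N HN]. exists (2 * N)%nat. intros n Hn. apply HN.
  apply Nat.div_le_lower_bound; lia.
Qed.

Lemma rsum_minus_le f i n m :
  (forall j, 0 <= f j) -> (i <= n)%nat -> (i <= m)%nat ->
  forall l, (forall k, rsum f k <= l) -> rsum f n - rsum f m <= l - rsum f i.
Proof.
  intros Hf Hn Hm l Hl. assert (H1 := Hl n).
  assert (rsum f i <= rsum f m) by now apply rsum_incr. lra.
Qed.

Lemma Cmod_csum_diff_le f n m :
  (m <= n)%nat ->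
  Cmod (csum f n - csum f m)%C
  <= rsum (fun i => Cmod (f i)) n - rsum (fun i => Cmod (f i)) m.
Proof.
  intros H. replace n with (m + (n - m))%nat by lia.
  rewrite csum_split, rsum_split.
  assert (H1 := Cmod_csum_le (fun i => f (m + i)%nat) (n - m)).
  match goal with |- Cmod ?x <= _ =>
    replace x with (csum (fun i => f (m + i)%nat) (n - m)) by ring end.
  lra.
Qed.

(* Mertens: the defect of the Cauchy product at [N] is
   [sum_(i<N) b_i (A_N - A_(N-i))]; for [i < N/2] the second factor is a tail of the
   series of [a], and the terms with [i >= N/2] form a tail of the series of [b]. *)
Lemma Cauchy_product a b la lb A B :
  Ccv (csum a) la -> Ccv (csum b) lb ->
  (forall n, rsum (fun i => Cmod (a i)) n <= A) ->
  (forall n, rsum (fun i => Cmod (b i)) n <= B) ->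
  Ccv (csum (conv a b)) (la * lb)%C.
Proof.
  intros Ha Hb HA HB.
  set (p := fun i => Cmod (a i)). set (q := fun i => Cmod (b i)).
  assert (Hp : forall i, 0 <= p i) by (intros; apply Cmod_ge_0).
  assert (Hq : forall i, 0 <= q i) by (intros; apply Cmod_ge_0).
  assert (Ep : ex_series p) by (apply rsum_bounded_ex_series with A; easy).
  assert (Eq : ex_series q) by (apply rsum_bounded_ex_series with B; easy).
  set (P := Series p). set (Q := Series q).
  assert (HP : forall n, rsum p n <= P) by (intros; now apply rsum_le_Series).
  assert (HQ : forall n, rsum q n <= Q) by (intros; now apply rsum_le_Series).
  assert (LP : is_lim_seq (fun n => rsum p (n / 2)) P).
  { apply (is_lim_seq_subseq (rsum p) P (fun n => (n / 2)%nat) filterlim_half).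
    apply is_series_rsum. now apply Series_correct. }
  assert (LQ : is_lim_seq (fun n => rsum q (n / 2)) Q).
  { apply (is_lim_seq_subseq (rsum q) Q (fun n => (n / 2)%nat) filterlim_half).
    apply is_series_rsum. now apply Series_correct. }
  assert (D : Ccv (fun n => (csum a n * csum b n - csum (conv a b) n)%C) 0%C).
  { apply Ccv_squeeze with
      (fun n => Q * (P - rsum p (n / 2)) + P * (Q - rsum q (n / 2))).
    2:{ replace (Finite 0) with (Finite (Q * (P - P) + P * (Q - Q))) by (f_equal; ring).
        apply is_lim_seq_plus'; apply is_lim_seq_mult'; try apply is_lim_seq_const;
          apply is_lim_seq_minus'; try apply is_lim_seq_const; easy. }
    intros n. set (m := (n / 2)%nat).
    assert (Hm : (m <= n)%nat) by (apply Nat.Div0.div_le_upper_bound; lia).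
    assert (Hm2 : (2 * m <= n)%nat) by apply Nat.Div0.mul_div_le.
    match goal with |- Cmod ?x <= _ =>
      replace x with (csum (fun i => b i * (csum a n - csum a (n - i)))%C n) end.
    2:{ rewrite csum_conv. replace (csum a n * csum b n)%C
          with (csum (fun i => (b i * csum a n)%C) n) by (rewrite csum_scal_r; ring).
        rewrite (csum_ext _ (fun i => (b i * csum a n - b i * csum a (n - i))%C))
          by (intros; ring).
        rewrite csum_minus. ring. }
    eapply Rle_trans; [apply Cmod_csum_le|].
    replace n with (m + (n - m))%nat at 1 by lia. rewrite rsum_split.
    apply Rplus_le_compat.
    - apply Rle_trans with (rsum (fun i => (P - rsum p m) * q i) m).
      + apply rsum_le. intros i Hi. rewrite Cmod_mult, Rmult_comm.
        apply Rmult_le_compat_r; [apply Hq|].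
        eapply Rle_trans; [apply Cmod_csum_diff_le; lia|].
        apply rsum_minus_le; try easy; lia.
      + rewrite rsum_scal, Rmult_comm. apply Rmult_le_compat_r; [|apply HQ].
        specialize (HP m). lra.
    - apply Rle_trans with (rsum (fun i => P * q (m + i)%nat) (n - m)).
      + apply rsum_le. intros i Hi. rewrite Cmod_mult, Rmult_comm.
        apply Rmult_le_compat_r; [apply Hq|].
        eapply Rle_trans; [apply Cmod_csum_diff_le; lia|].
        fold p. assert (0 <= rsum p (n - (m + i))) by now apply rsum_nonneg.
        specialize (HP n). lra.
      + rewrite rsum_scal. apply Rmult_le_compat_l.
        * specialize (HP 0%nat). simpl in HP. lra.
        * specialize (HQ n). replace n with (m + (n - m))%nat in HQ at 1 by lia.
          rewrite rsum_split in HQ. lra. }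
  apply Ccv_ext with
    (fun n => (csum a n * csum b n + (-(1)) * (csum a n * csum b n - csum (conv a b) n))%C).
  { intros n. ring. }
  replace (la * lb)%C with (la * lb + (-(1)) * 0)%C by ring.
  apply Ccv_plus; [now apply Ccv_mult|now apply Ccv_scal].
Qed.

Lemma pseries_Ccv a f z :
  is_pseries_on_D a f -> inD z -> Ccv (csum (fun n => (a n * z ^ n)%C)) (f z).
Proof. intros H Hz. apply is_series_Ccv. now apply H. Qed.

Lemma pseries_abs a f r :
  is_pseries_on_D a f -> 0 <= r < 1 ->
  exists B, forall n, rsum (fun k => Cmod (a k) * r ^ k) n <= B.
Proof.
  intros Hf Hr. set (rho := (1 + r) / 2).
  assert (Hrho : 0 < rho < 1 /\ r < rho) by (unfold rho; lra).
  assert (Hz : inD (RtoC rho)).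
  { unfold inD. rewrite Cmod_R, Rabs_pos_eq; lra. }
  assert (L := Ccv_Cmod _ _ (pseries_Ccv a f _ Hf Hz)).
  destruct (filterlim_bounded (K := R_AbsRing) (V := R_NormedModule)
    (fun n => Cmod (csum (fun n => (a n * rho ^ n)%C) n))) as [M HM].
  { eexists. exact L. }
  assert (HM' : forall n, Cmod (csum (fun n => (a n * rho ^ n)%C) n) <= M).
  { intros n. specialize (HM n). change (Rabs (Cmod (csum (fun n => (a n * rho ^ n)%C) n)) <= M) in HM.
    rewrite Rabs_pos_eq in HM; [easy|apply Cmod_ge_0]. }
  assert (Ht : forall k, Cmod (a k) * rho ^ k <= 2 * M).
  { intros k.
    replace (Cmod (a k) * rho ^ k) with (Cmod (a k * rho ^ k)%C).
    2:{ rewrite Cmod_mult, Cmod_pow, Cmod_R, Rabs_pos_eq; lra. }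
    replace (a k * rho ^ k)%C with
      (csum (fun n => (a n * rho ^ n)%C) (S k) + - csum (fun n => (a n * rho ^ n)%C) k)%C
      by (cbn [csum]; ring).
    eapply Rle_trans; [apply Cmod_triangle|]. rewrite Cmod_opp.
    assert (H1 := HM' k). assert (H2 := HM' (S k)). lra. }
  assert (Hq : 0 <= r / rho < 1).
  { split; [apply Rmult_le_pos; [lra|left; apply Rinv_0_lt_compat; lra]|].
    apply Rmult_lt_reg_r with rho; [lra|]. unfold Rdiv.
    rewrite Rmult_assoc, Rinv_l; lra. }
  exists (2 * M * / (1 - r / rho)). intros n.
  apply Rle_trans with (rsum (fun k => 2 * M * (r / rho) ^ k) n).
  - apply rsum_le. intros k _.
    replace (Cmod (a k) * r ^ k) with (Cmod (a k) * rho ^ k * (r / rho) ^ k).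
    + apply Rmult_le_compat_r; [apply pow_le; lra|apply Ht].
    + rewrite Rmult_assoc, <- Rpow_mult_distr. f_equal. f_equal. field. lra.
  - rewrite rsum_scal. apply Rmult_le_compat_l; [|now apply rsum_geom_le].
    specialize (Ht 0%nat). simpl in Ht. assert (H1 := Cmod_ge_0 (a 0%nat)). lra.
Qed.

Lemma pseries_abs_at a f z :
  is_pseries_on_D a f -> inD z ->
  exists B, forall n, rsum (fun k => Cmod (a k * z ^ k)%C) n <= B.
Proof.
  intros Hf Hz. destruct (pseries_abs a f (Cmod z) Hf) as [B HB].
  { split; [apply Cmod_ge_0|apply Hz]. }
  exists B. intros n. eapply Rle_trans; [|apply HB].
  right. apply rsum_ext. intros. now rewrite Cmod_mult, Cmod_pow.
Qed.

Lemma conv_weighted a b z n :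
  (conv a b n * z ^ n)%C = conv (fun k => a k * z ^ k)%C (fun k => b k * z ^ k)%C n.
Proof.
  unfold conv. rewrite <- csum_scal_r. apply csum_ext. intros j Hj.
  replace n with ((n - j) + j)%nat at 2 by lia. rewrite Cpow_add_r. ring.
Qed.

Lemma pseries_mult a b f g :
  is_pseries_on_D a f -> is_pseries_on_D b g ->
  is_pseries_on_D (conv a b) (fun z => f z * g z)%C.
Proof.
  intros Hf Hg z Hz. apply is_series_Ccv.
  destruct (pseries_abs_at a f z Hf Hz) as [A HA].
  destruct (pseries_abs_at b g z Hg Hz) as [B HB].
  apply Ccv_ext with (csum (conv (fun k => a k * z ^ k)%C (fun k => b k * z ^ k)%C)).
  { intros n. apply csum_ext. intros. now rewrite conv_weighted. }
  apply Cauchy_product with A B; try easy; now apply pseries_Ccv.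
Qed.

Lemma pseries_ext a b f g :
  (forall n, a n = b n) -> (forall z, inD z -> f z = g z) ->
  is_pseries_on_D a f -> is_pseries_on_D b g.
Proof.
  intros Hab Hfg H z Hz. rewrite <- Hfg by easy. apply is_series_Ccv.
  apply Ccv_ext with (csum (fun n => (a n * z ^ n)%C)).
  - intros n. apply csum_ext. intros. now rewrite Hab.
  - now apply pseries_Ccv.
Qed.

Lemma pseries_plus a b f g :
  is_pseries_on_D a f -> is_pseries_on_D b g ->
  is_pseries_on_D (fun n => a n + b n)%C (fun z => f z + g z)%C.
Proof.
  intros Hf Hg z Hz. apply is_series_Ccv.
  apply Ccv_ext with
    (fun n => csum (fun n => (a n * z ^ n)%C) n + csum (fun n => (b n * z ^ n)%C) n)%C.
  - intros n. rewrite <- csum_plus. apply csum_ext. intros. ring.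
  - apply Ccv_plus; now apply pseries_Ccv.
Qed.

Lemma pseries_scal c a f :
  is_pseries_on_D a f -> is_pseries_on_D (fun n => c * a n)%C (fun z => c * f z)%C.
Proof.
  intros Hf z Hz. apply is_series_Ccv.
  apply Ccv_ext with (fun n => c * csum (fun n => (a n * z ^ n)%C) n)%C.
  - intros n. rewrite <- csum_scal. apply csum_ext. intros. ring.
  - apply Ccv_scal; now apply pseries_Ccv.
Qed.

Lemma pseries_minus a b f g :
  is_pseries_on_D a f -> is_pseries_on_D b g ->
  is_pseries_on_D (fun n => a n - b n)%C (fun z => f z - g z)%C.
Proof.
  intros Hf Hg.
  apply pseries_ext with (fun n => a n + (-(1)) * b n)%C (fun z => f z + (-(1)) * g z)%C.
  - intros; ring.
  - intros; ring.
  - apply pseries_plus; [easy|now apply pseries_scal].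
Qed.

Lemma pseries_monomial k : is_pseries_on_D (cdelta k) (fun z => z ^ k)%C.
Proof.
  intros z Hz. apply is_series_Ccv.
  apply (is_lim_seq_incr_n _ (S k)).
  apply Ccv_ext with (fun _ => (z ^ k)%C); [|apply Ccv_const].
  intros n. rewrite (csum_single _ _ k).
  - unfold cdelta. rewrite Nat.eqb_refl. ring.
  - lia.
  - intros i _ Hi. unfold cdelta. apply Nat.eqb_neq in Hi. rewrite Hi. ring.
Qed.

Lemma pseries_pow a f k :
  is_pseries_on_D a f -> exists b, is_pseries_on_D b (fun z => f z ^ k)%C.
Proof.
  intros Hf. induction k as [|k [b IH]].
  - exists (cdelta 0). exact (pseries_monomial 0).
  - exists (conv a b). exact (pseries_mult a b f _ Hf IH).
Qed.

Lemma pseries_exists a :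
  (forall z, inD z -> exists l, Ccv (csum (fun n => (a n * z ^ n)%C)) l) ->
  exists f, is_pseries_on_D a f.
Proof.
  intros H.
  (* The sum is selected by choice; off the disk its value is arbitrary. *)
  exists (fun z => epsilon (A := C) (inhabits (RtoC 0)) (fun l => Ccv (csum (fun n => (a n * z ^ n)%C)) l)).
  intros z Hz. apply is_series_Ccv. apply epsilon_spec. now apply H.
Qed.

Lemma Cmod2_lt_1 z : inD z -> 0 <= Cmod z ^ 2 < 1.
Proof. unfold inD. intros H. assert (H0 := Cmod_ge_0 z). split; nra. Qed.

Lemma rsum_Cmod2_pow_le z n :
  inD z -> rsum (fun k => Cmod (z ^ k)%C ^ 2) n <= / (1 - Cmod z ^ 2).
Proof.
  intros Hz. apply Rle_trans with (rsum (fun k => (Cmod z ^ 2) ^ k) n).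
  - right. apply rsum_ext. intros. rewrite Cmod_pow, <- !pow_mult. f_equal. lia.
  - apply rsum_geom_le. now apply Cmod2_lt_1.
Qed.

Lemma pseries_l2_exists a A :
  (forall n, rsum (fun k => Cmod (a k) ^ 2) n <= A) -> exists f, is_pseries_on_D a f.
Proof.
  intros HA. apply pseries_exists. intros z Hz.
  apply csum_abs_cv with (fun k => / 2 * Cmod (a k) ^ 2 + / 2 * Cmod (z ^ k)%C ^ 2)
    (/ 2 * A + / 2 * / (1 - Cmod z ^ 2)).
  - intros k. rewrite Cmod_mult.
    assert (H := Rmult_le_AMGM (Cmod (a k)) (Cmod (z ^ k)%C)). lra.
  - intros n. rewrite rsum_plus, !rsum_scal.
    assert (H1 := HA n). assert (H2 := rsum_Cmod2_pow_le z n Hz). lra.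
Qed.

Lemma pseries_bounded_exists a A :
  (forall n, Cmod (a n) <= A) -> exists f, is_pseries_on_D a f.
Proof.
  intros HA. apply pseries_exists. intros z Hz.
  assert (H0 := Cmod_ge_0 z).
  apply csum_abs_cv with (fun k => A * Cmod z ^ k) (A * / (1 - Cmod z)).
  - intros k. rewrite Cmod_mult, Cmod_pow.
    apply Rmult_le_compat_r; [now apply pow_le|apply HA].
  - intros n. rewrite rsum_scal. apply Rmult_le_compat_l.
    + specialize (HA 0%nat). assert (H1 := Cmod_ge_0 (a 0%nat)). lra.
    + now apply rsum_geom_le.
Qed.

(* Cauchy--Schwarz on the tail of the power series. *)
Lemma pseries_tail_bound a f A n z :
  is_pseries_on_D a f -> (forall m, rsum (fun k => Cmod (a k) ^ 2) m <= A) -> inD z ->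
  Cmod (f z - csum (fun k => (a k * z ^ k)%C) n)%C ^ 2
  <= A * ((Cmod z ^ 2) ^ n * / (1 - Cmod z ^ 2)).
Proof.
  intros Hf HA Hz.
  assert (Hy := Cmod2_lt_1 z Hz).
  set (s := csum (fun k => (a k * z ^ k)%C)).
  assert (L : is_lim_seq (fun m => Cmod (s (m + n)%nat - s n)%C ^ 2)
                (Cmod (f z - s n)%C ^ 2)).
  { apply is_lim_seq_ext with
      (fun m => Cmod (s (m + n)%nat - s n)%C * Cmod (s (m + n)%nat - s n)%C).
    { intros; ring. }
    replace (Cmod (f z - s n)%C ^ 2) with (Cmod (f z - s n)%C * Cmod (f z - s n)%C) by ring.
    assert (Ccv (fun m => s (m + n)%nat - s n)%C (f z - s n)%C).
    { apply Ccv_plus; [|apply Ccv_const].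
      apply (Ccv_shift s). now apply pseries_Ccv. }
    apply is_lim_seq_mult'; now apply Ccv_Cmod. }
  apply (is_lim_seq_le_const _ _ _ L). intros m.
  replace (s (m + n)%nat - s n)%C with
    (csum (fun k => (a (n + k)%nat * z ^ (n + k))%C) m).
  2:{ unfold s. rewrite Nat.add_comm, csum_split. ring. }
  eapply Rle_trans; [apply csum_Cauchy_Schwarz|].
  apply Rmult_le_compat.
  - apply rsum_nonneg. intros. apply Cmod2_nonneg.
  - apply rsum_nonneg. intros. apply Cmod2_nonneg.
  - eapply Rle_trans; [|apply (HA (n + m)%nat)]. rewrite rsum_split.
    assert (0 <= rsum (fun k => Cmod (a k) ^ 2) n)
      by (apply rsum_nonneg; intros; apply Cmod2_nonneg). lra.
  - rewrite (rsum_ext _ (fun k => (Cmod z ^ 2) ^ n * Cmod (z ^ k)%C ^ 2)).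
    + rewrite rsum_scal. apply Rmult_le_compat_l; [apply pow_le; lra|].
      now apply rsum_Cmod2_pow_le.
    + intros k _. rewrite Cpow_add_r, Cmod2_mult. f_equal.
      rewrite Cmod_pow, <- !pow_mult. f_equal. lia.
Qed.

(** * Bounded analytic functions are in the Hardy space *)

Definition unit_root (M : nat) : C := (cos (2 * PI / INR M), sin (2 * PI / INR M)).

Lemma Cpow_cis t k : ((cos t, sin t) ^ k)%C = (cos (INR k * t), sin (INR k * t)).
Proof.
  induction k as [|k IH].
  - simpl. rewrite Rmult_0_l, cos_0, sin_0. easy.
  - rewrite Cpow_S, IH, S_INR.
    replace ((INR k + 1) * t) with (t + INR k * t) by ring.
    rewrite cos_plus, sin_plus. unfold Cmult. simpl. f_equal; ring.
Qed.

Lemma unit_root_pow_M M : (0 < M)%nat -> (unit_root M ^ M)%C = 1%C.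
Proof.
  intros HM. apply lt_0_INR in HM. unfold unit_root. rewrite Cpow_cis.
  replace (INR M * (2 * PI / INR M)) with (2 * PI) by (field; lra).
  now rewrite cos_2PI, sin_2PI.
Qed.

Lemma unit_root_pow_neq_1 M k : (0 < k < M)%nat -> (unit_root M ^ k)%C <> 1%C.
Proof.
  intros Hk E. unfold unit_root in E. rewrite Cpow_cis in E.
  assert (H0 : 0 < INR k) by (apply lt_0_INR; lia).
  assert (H1 : INR k < INR M) by (apply lt_INR; lia).
  assert (HPI := PI_RGT_0).
  injection E as Ec _.
  (* Half of the angle: [cos (2 x) = 1 - 2 sin(x)^2] equals 1 only if [sin x = 0], whereas
     [0 < x < PI]. *)
  set (x := INR k * (PI / INR M)).
  replace (INR k * (2 * PI / INR M)) with (2 * x) in Ec by (unfold x; field; lra).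
  rewrite cos_2a_sin in Ec.
  assert (0 < sin x).
  { apply sin_gt_0; unfold x.
    - apply Rmult_lt_0_compat; [easy|]. apply Rdiv_lt_0_compat; lra.
    - replace (INR k * (PI / INR M)) with (PI * (INR k / INR M)) by (field; lra).
      rewrite <- Rmult_1_r. apply Rmult_lt_compat_l; [easy|].
      apply Rmult_lt_reg_r with (INR M); [lra|]. unfold Rdiv.
      rewrite Rmult_assoc, Rinv_l; lra. }
  nra.
Qed.

Lemma Cmod_unit_root M : Cmod (unit_root M) = 1.
Proof.
  unfold Cmod, unit_root. simpl fst. simpl snd.
  replace (_ + _) with 1; [apply sqrt_1|].
  rewrite <- (sin2_cos2 (2 * PI / INR M)). unfold Rsqr. ring.
Qed.

Lemma csum_geom x n : ((x - 1) * csum (fun i => x ^ i) n = x ^ n - 1)%C.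
Proof.
  induction n as [|n IH]; cbn [csum].
  - simpl. ring.
  - rewrite Cmult_plus_distr_l, IH, Cpow_S. ring.
Qed.

Lemma unit_root_orth M k l :
  (k < M)%nat -> (l < M)%nat ->
  csum (fun j => (unit_root M ^ j) ^ k * Cconj ((unit_root M ^ j) ^ l))%C M =
  if Nat.eqb k l then RtoC (INR M) else 0%C.
Proof.
  intros Hk Hl. set (om := unit_root M).
  assert (Hu : (om * Cconj om = 1)%C).
  { rewrite <- Cmod2_conj. unfold om. rewrite Cmod_unit_root. f_equal. ring. }
  assert (Hun : forall i, (om ^ i * Cconj om ^ i = 1)%C).
  { intros i. now rewrite <- Cpow_mult_l, Hu, Cpow_1_l. }
  assert (HM : (om ^ M = 1)%C) by (apply unit_root_pow_M; lia).
  assert (E : forall j, ((om ^ j) ^ k * Cconj ((om ^ j) ^ l) = (om ^ k * Cconj om ^ l) ^ j)%C).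
  { intros j. rewrite !Cpow_conj, Cpow_mult_l, <- !Cpow_mult_r.
    rewrite (Nat.mul_comm k), (Nat.mul_comm l). easy. }
  rewrite (csum_ext _ (fun j => (om ^ k * Cconj om ^ l) ^ j)%C) by (intros; apply E).
  set (x := (om ^ k * Cconj om ^ l)%C).
  assert (HxM : (x ^ M = 1)%C).
  { unfold x. rewrite Cpow_mult_l, <- !Cpow_mult_r, !(Nat.mul_comm _ M), !Cpow_mult_r, HM.
    rewrite <- (Cpow_conj om), HM, Cpow_1_l.
    replace (Cconj 1) with (1 : C) by (unfold Cconj; simpl; now rewrite Ropp_0).
    rewrite Cpow_1_l. ring. }
  destruct (Nat.eqb_spec k l) as [->|Hne].
  - unfold x. rewrite Hun. rewrite (csum_ext _ (fun _ => 1%C)) by (intros; apply Cpow_1_l).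
    rewrite csum_const. ring.
  - assert (Hx : x <> 1%C).
    { intros Ex. unfold x in Ex. destruct (Nat.lt_ge_cases l k) as [H|H].
      - apply (unit_root_pow_neq_1 M (k - l)); [lia|]. fold om.
        rewrite <- Ex. replace k with (k - l + l)%nat at 2 by lia.
        rewrite Cpow_add_r, <- Cmult_assoc, Hun. ring.
      - apply (unit_root_pow_neq_1 M (l - k)); [lia|]. fold om.
        replace (om ^ (l - k))%C with (om ^ (l - k) * (om ^ k * Cconj om ^ l))%C
          by (rewrite Ex; ring).
        rewrite Cmult_assoc, <- Cpow_add_r. replace (l - k + k)%nat with l by lia. apply Hun. }
    assert (G := csum_geom x M). rewrite HxM in G.
    replace (1 - 1)%C with (0 : C) in G by ring.
    destruct (Ceq_dec (csum (fun i => x ^ i)%C M) 0%C) as [E0|N0]; [easy|].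
    exfalso. apply Cmult_neq_0 in G; [easy| |easy].
    intros H. apply Hx. replace x with (x - 1 + 1)%C by ring. rewrite H. ring.
Qed.

(** The squares are expanded into a double sum over pairs of exponents; summing over the roots first
    leaves only the diagonal. Distinct exponents below [M] are told apart by the [M]-th roots, so
    the identity is exact for polynomials of degree below [M]. *)
Lemma Parseval_discrete a M :
  rsum (fun j => Cmod (csum (fun k => a k * (unit_root M ^ j) ^ k)%C M) ^ 2) M
  = INR M * rsum (fun k => Cmod (a k) ^ 2) M.
Proof.
  apply RtoC_inj. rewrite RtoC_mult, !RtoC_rsum.
  set (e := fun j k => ((unit_root M ^ j) ^ k)%C).
  rewrite (csum_ext _ (fun j => csum (fun k => csum (fun l =>
     (a k * Cconj (a l)) * (e j k * Cconj (e j l)))%C M) M)).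
  2:{ intros j _. rewrite Cmod2_conj, Cconj_csum.
      rewrite <- csum_scal_r. apply csum_ext. intros k _.
      rewrite <- csum_scal. apply csum_ext. intros l _.
      unfold e. rewrite Cmult_conj. ring. }
  rewrite csum_switch, <- csum_scal. apply csum_ext. intros k Hk.
  rewrite csum_switch.
  rewrite (csum_single _ _ k Hk).
  - rewrite csum_scal. unfold e. rewrite unit_root_orth by easy.
    rewrite Nat.eqb_refl, Cmod2_conj. ring.
  - intros l Hl Hne. rewrite csum_scal. unfold e. rewrite unit_root_orth by easy.
    replace (k =? l)%nat with false by (symmetry; apply Nat.eqb_neq; lia). ring.
Qed.

Lemma is_lim_seq_pow_1 u k :
  is_lim_seq u 1 -> is_lim_seq (fun n => u n ^ k) 1.
Proof.
  intros Hu. induction k as [|k IH]; simpl.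
  - apply is_lim_seq_const.
  - replace (Finite 1) with (Finite (1 * 1)) by (f_equal; ring).
    now apply is_lim_seq_mult'.
Qed.

Lemma is_lim_seq_1_minus_inv : is_lim_seq (fun n => 1 - / (INR n + 1)) 1.
Proof.
  replace (Finite 1) with (Finite (1 - 0)) by (f_equal; ring).
  apply is_lim_seq_minus'; [apply is_lim_seq_const|].
  replace (Finite 0) with (Rbar_inv p_infty) by easy.
  apply is_lim_seq_inv; [|easy].
  apply is_lim_seq_ext with (fun n => INR (S n)); [intros; apply S_INR|].
  apply (is_lim_seq_incr_1 INR). apply is_lim_seq_INR.
Qed.

(* Parseval for the average of [|f|^2] over the [M]-th roots of unity on the circle of
   radius [r], as [M] tends to infinity. *)
Lemma pseries_bounded_coeffs_radius a f c r K :
  is_pseries_on_D a f -> (forall z, inD z -> Cmod (f z) <= c) -> 0 <= r < 1 ->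
  rsum (fun k => Cmod (a k * r ^ k)%C ^ 2) K <= c ^ 2.
Proof.
  intros Hf Hc Hr.
  set (p := fun k => Cmod (a k) * r ^ k).
  assert (Hp : forall k, 0 <= p k)
    by (intros; apply Rmult_le_pos; [apply Cmod_ge_0|apply pow_le; lra]).
  destruct (pseries_abs a f r Hf Hr) as [B HB].
  assert (Ep : ex_series p) by now apply rsum_bounded_ex_series with B.
  set (S := Series p).
  assert (HS : forall n, rsum p n <= S) by (intros; now apply rsum_le_Series).
  assert (LS : is_lim_seq (rsum p) S) by (apply is_series_rsum; now apply Series_correct).
  assert (c0 : 0 <= c).
  { eapply Rle_trans; [apply Cmod_ge_0|apply (Hc 0%C)]. unfold inD. rewrite Cmod_0. lra. }
  (* The discrete Parseval identity handles only polynomials, so [f] is replaced by its truncation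
     at [M]. On the circle of radius [r] the error is at most the tail of the absolute series,
     uniformly in [z]. *)
  assert (Htail : forall z M, Cmod z = r ->
    Cmod (csum (fun k => a k * z ^ k)%C M) <= c + (S - rsum p M)).
  { intros z M Hz.
    assert (Dz : inD z) by (unfold inD; lra).
    set (s := csum (fun k => (a k * z ^ k)%C)).
    assert (H1 : Cmod (f z - s M)%C <= S - rsum p M).
    { apply Ccv_Cmod_le with (fun m => s (m + M)%nat - s M)%C.
      - apply Ccv_plus; [|apply Ccv_const]. apply (Ccv_shift s). now apply pseries_Ccv.
      - intros m. eapply Rle_trans; [apply Cmod_csum_diff_le; lia|].
        rewrite !(rsum_ext (fun i => Cmod (a i * z ^ i)%C) p).
        + specialize (HS (m + M)%nat). lra.
        + intros. unfold p. now rewrite Cmod_mult, Cmod_pow, Hz.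
        + intros. unfold p. now rewrite Cmod_mult, Cmod_pow, Hz. }
    assert (H2 := Hc z Dz).
    assert (H3 := Cmod_triangle (f z) (- (f z - s M))%C). rewrite Cmod_opp in H3.
    replace (f z + - (f z - s M))%C with (s M) in H3 by ring. lra. }
  assert (HM : forall M, (0 < M)%nat ->
    rsum (fun k => Cmod (a k * r ^ k)%C ^ 2) M <= (c + (S - rsum p M)) ^ 2).
  { intros M HM.
    assert (HM' : 0 < INR M) by now apply lt_0_INR.
    apply Rmult_le_reg_l with (INR M); [easy|].
    rewrite <- Parseval_discrete, <- rsum_const.
    apply rsum_le. intros j _. apply pow_incr. split; [apply Cmod_ge_0|].
    rewrite (csum_ext _ (fun k => a k * (r * unit_root M ^ j) ^ k)%C)
      by (intros; rewrite Cpow_mult_l; ring).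
    apply Htail. rewrite Cmod_mult, Cmod_pow, Cmod_unit_root, pow1, Cmod_R, Rabs_pos_eq; lra. }
  assert (L : is_lim_seq (fun M => (c + (S - rsum p M)) ^ 2) (c ^ 2)).
  { apply is_lim_seq_ext with (fun M => (c + (S - rsum p M)) * (c + (S - rsum p M))).
    { intros; ring. }
    replace (Finite (c ^ 2)) with (Finite ((c + (S - S)) * (c + (S - S))))
      by (f_equal; ring).
    assert (is_lim_seq (fun M => c + (S - rsum p M)) (c + (S - S))).
    { apply is_lim_seq_plus'; [apply is_lim_seq_const|].
      apply is_lim_seq_minus'; [apply is_lim_seq_const|easy]. }
    now apply is_lim_seq_mult'. }
  apply (is_lim_seq_incr_n _ (1 + K)) in L.
  apply (is_lim_seq_ge_const _ _ _ L). intros n.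
  eapply Rle_trans; [|apply HM; lia].
  apply rsum_incr; [intros; apply Cmod2_nonneg|lia].
Qed.

(** The bound on radius [r] is uniform in [r]; for a fixed number [K] of coefficients let
    [r = 1 - 1/(n+1)] tend to 1. *)
Lemma pseries_bounded_coeffs a f c K :
  is_pseries_on_D a f -> (forall z, inD z -> Cmod (f z) <= c) ->
  rsum (fun k => Cmod (a k) ^ 2) K <= c ^ 2.
Proof.
  intros Hf Hc.
  set (r := fun n => 1 - / (INR n + 1)).
  assert (Hr : forall n, 0 <= r n < 1).
  { intros n. unfold r. assert (H := pos_INR n).
    assert (0 < / (INR n + 1)) by (apply Rinv_0_lt_compat; lra).
    assert (/ (INR n + 1) <= 1) by (rewrite <- Rinv_1; apply Rinv_le_contravar; lra). lra. }
  apply (is_lim_seq_le_const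
    (fun n => rsum (fun k => Cmod (a k) ^ 2 * r n ^ (2 * k)) K)).
  - apply is_lim_seq_rsum. intros k _.
    replace (Finite (Cmod (a k) ^ 2)) with (Finite (Cmod (a k) ^ 2 * 1)) by (f_equal; ring).
    apply is_lim_seq_mult'; [apply is_lim_seq_const|].
    apply is_lim_seq_pow_1. apply is_lim_seq_1_minus_inv.
  - intros n. eapply Rle_trans; [|apply (pseries_bounded_coeffs_radius a f c (r n) K); auto].
    right. apply rsum_ext. intros k _.
    specialize (Hr n).
    rewrite Cmod2_mult, Cmod_pow, Cmod_R, Rabs_pos_eq, <- pow_mult, Nat.mul_comm by lra.
    easy.
Qed.

(** The difference is a power series bounded by 0 on the disk, so the preceding estimate with
    [c = 0] annihilates its coefficients. *)
Lemma pseries_coeffs_unique a b f g :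
  is_pseries_on_D a f -> is_pseries_on_D b g ->
  (forall z, inD z -> f z = g z) -> forall n, a n = b n.
Proof.
  intros Hf Hg E n.
  assert (H := pseries_bounded_coeffs _ _ 0 (S n) (pseries_minus a b f g Hf Hg)).
  assert (H1 : rsum (fun k => Cmod (a k - b k)%C ^ 2) (S n) <= 0 ^ 2).
  { apply H. intros z Hz. rewrite E by easy.
    replace (g z - g z)%C with (0 : C) by ring. rewrite Cmod_0. lra. }
  assert (H2 : Cmod (a n - b n)%C ^ 2 <= rsum (fun k => Cmod (a k - b k)%C ^ 2) (S n)).
  { apply (rsum_ge_term (fun k => Cmod (a k - b k)%C ^ 2)); [intros; apply Cmod2_nonneg|lia]. }
  assert (E0 : (a n - b n)%C = 0%C) by (apply Cmod2_eq_0; lra).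
  replace (a n) with (b n + (a n - b n))%C by ring. rewrite E0. ring.
Qed.

(** * Norms and linear combinations in the Hardy space *)

Lemma l2sum_ge a n :
  ex_series (fun k => Cmod (a k) ^ 2) -> rsum (fun k => Cmod (a k) ^ 2) n <= l2sum a.
Proof. intros H. apply rsum_le_Series; [intros; apply Cmod2_nonneg|easy]. Qed.

Lemma l2_ex_series a A :
  (forall n, rsum (fun k => Cmod (a k) ^ 2) n <= A) -> ex_series (fun k => Cmod (a k) ^ 2).
Proof. apply rsum_bounded_ex_series. intros; apply Cmod2_nonneg. Qed.

Lemma l2sum_le a A : (forall n, rsum (fun k => Cmod (a k) ^ 2) n <= A) -> l2sum a <= A.
Proof. intros H. apply Series_le_rsum; [now apply l2_ex_series with A|easy]. Qed.

Lemma l2sum_ext a b : (forall n, a n = b n) -> l2sum a = l2sum b.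
Proof. intros H. apply Series_ext. intros. now rewrite H. Qed.

Lemma l2sum_nonneg a : ex_series (fun k => Cmod (a k) ^ 2) -> 0 <= l2sum a.
Proof. intros H. apply (l2sum_ge a 0 H). Qed.

Lemma H2_coeffs_plus a b f g :
  is_H2_coeffs a f -> is_H2_coeffs b g ->
  is_H2_coeffs (fun n => a n + b n)%C (fun z => f z + g z)%C.
Proof.
  intros [Ha Hf] [Hb Hg]. split; [|now apply pseries_plus].
  apply l2_ex_series with (2 * l2sum a + 2 * l2sum b). intros n.
  apply Rle_trans with (rsum (fun k => 2 * Cmod (a k) ^ 2 + 2 * Cmod (b k) ^ 2) n).
  - apply rsum_le. intros. apply Cmod2_plus_le.
  - rewrite rsum_plus, !rsum_scal.
    assert (H1 := l2sum_ge a n Ha). assert (H2 := l2sum_ge b n Hb). lra.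
Qed.

Lemma H2_coeffs_scal c a f :
  is_H2_coeffs a f -> is_H2_coeffs (fun n => c * a n)%C (fun z => c * f z)%C.
Proof.
  intros [Ha Hf]. split; [|now apply pseries_scal].
  apply l2_ex_series with (Cmod c ^ 2 * l2sum a). intros n.
  rewrite (rsum_ext _ (fun k => Cmod c ^ 2 * Cmod (a k) ^ 2)) by (intros; apply Cmod2_mult).
  rewrite rsum_scal. apply Rmult_le_compat_l; [apply Cmod2_nonneg|now apply l2sum_ge].
Qed.

Lemma H2_coeffs_ext a b f g :
  (forall n, a n = b n) -> (forall z, inD z -> f z = g z) ->
  is_H2_coeffs a f -> is_H2_coeffs b g.
Proof.
  intros Hab Hfg [Ha Hf]. split; [|now apply pseries_ext with a f].
  apply ex_series_ext with (2 := Ha). intros. now rewrite Hab.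
Qed.

Lemma H2_coeffs_0 : is_H2_coeffs (fun _ => 0%C) (fun _ => 0%C).
Proof.
  split.
  - apply l2_ex_series with 0. intros n. rewrite rsum_const, Cmod_0. lra.
  - intros z _. apply is_series_Ccv. apply Ccv_ext with (fun _ => 0%C); [|apply Ccv_const].
    intros n. symmetry. apply csum_0. intros. ring.
Qed.

Lemma H2_coeffs_lincomb (lam : nat -> C) (c : nat -> nat -> C) (g : nat -> C -> C) n :
  (forall i, (i < n)%nat -> is_H2_coeffs (c i) (g i)) ->
  is_H2_coeffs (fun k => csum (fun i => lam i * c i k)%C n) (lincomb lam g n).
Proof.
  induction n as [|n IH]; intros H.
  - apply H2_coeffs_0.
  - apply (H2_coeffs_plus (fun k => csum (fun i => lam i * c i k)%C n)
             (fun k => lam n * c n k)%C (lincomb lam g n) (fun z => lam n * g n z)%C).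
    + apply IH. intros. apply H. lia.
    + apply H2_coeffs_scal. apply H. lia.
Qed.

Lemma lincomb_csum lam g n z : lincomb lam g n z = csum (fun i => lam i * g i z)%C n.
Proof. induction n as [|n IH]; [easy|]. cbn [lincomb csum]. now rewrite IH. Qed.

Lemma rsum_Cmod2_delta k n : rsum (fun i => Cmod (cdelta k i) ^ 2) n <= 1.
Proof.
  induction n as [|n IH]; cbn [rsum]; [lra|].
  unfold cdelta at 2. destruct (Nat.eqb_spec n k) as [->|H].
  - rewrite (rsum_ext _ (fun _ => 0)), rsum_const, Cmod_1; [lra|].
    intros i Hi. unfold cdelta.
    replace (i =? k)%nat with false by (symmetry; apply Nat.eqb_neq; lia).
    rewrite Cmod_0. ring.
  - rewrite Cmod_0. lra.
Qed.

Lemma H2_coeffs_monomial k : is_H2_coeffs (cdelta k) (fun z => z ^ k)%C.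
Proof.
  split; [|apply pseries_monomial]. apply l2_ex_series with 1. apply rsum_Cmod2_delta.
Qed.

(** * Outer functions from positive Toeplitz forms *)

(* Testing the convolution operator on [x_j = conj z ^ j], the eigenvector of its adjoint. *)
Lemma contractive_conv_bound u f z :
  (forall x N, rsum (fun n => Cmod (conv u x n) ^ 2) N <= rsum (fun n => Cmod (x n) ^ 2) N) ->
  is_pseries_on_D u f -> inD z -> Cmod (f z) <= 1.
Proof.
  intros Hu Hf Hz.
  set (x := fun j => (Cconj z ^ j)%C).
  destruct (pseries_bounded_exists x 1) as [X HX].
  { intros n. unfold x. rewrite Cmod_pow, Cmod_conj. rewrite <- (pow1 n).
    apply pow_incr. split; [apply Cmod_ge_0|]. left. exact Hz. }
  set (s := fun N => rsum (fun k => Cmod (z ^ k)%C ^ 2) N).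
  assert (Es : forall N, csum (fun j => (x j * z ^ j)%C) N = RtoC (s N)).
  { intros N. unfold s. rewrite RtoC_rsum. apply csum_ext. intros j _.
    rewrite Cmod2_conj. unfold x. rewrite Cpow_conj. ring. }
  assert (s0 : forall N, 0 <= s N)
    by (intros; apply rsum_nonneg; intros; apply Cmod2_nonneg).
  assert (LX := pseries_Ccv x X z HX Hz).
  assert (LM := Ccv_Cmod _ _ LX).
  assert (Ls : is_lim_seq s (Cmod (X z))).
  { apply is_lim_seq_ext with (2 := LM). intros N.
    rewrite Es, Cmod_R, Rabs_pos_eq; easy. }
  assert (HX1 : 1 <= Cmod (X z)).
  { apply (is_lim_seq_incr_1 s) in Ls. apply (is_lim_seq_ge_const _ _ _ Ls).
    intros n. apply Rle_trans with (s 1%nat).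
    - unfold s. simpl. rewrite Cmod_1. lra.
    - apply rsum_incr; [intros; apply Cmod2_nonneg|lia]. }
  assert (HP := pseries_Ccv _ _ z (pseries_mult u x f X Hf HX) Hz). cbv beta in HP.
  apply Ccv_Cmod in HP.
  (* Here [X z = sum |z|^(2k)] is the limit of [s]. By Cauchy-Schwarz and contractivity the partial
     sums of [f z * X z] are bounded by [s N]; the factor [X z >= 1] is then cancelled. *)
  assert (HL : Rbar_le (Cmod (f z * X z)%C) (Cmod (X z))).
  { apply is_lim_seq_le with (2 := HP) (3 := Ls). intros N.
    apply Rsqr_incr_0_var; [|apply s0]. rewrite !Rsqr_pow2.
    eapply Rle_trans; [apply csum_Cauchy_Schwarz|].
    fold (s N). replace (s N ^ 2) with (s N * s N) by ring.
    apply Rmult_le_compat_r; [apply s0|].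
    eapply Rle_trans; [apply Hu|]. right. apply rsum_ext. intros k _.
    unfold x. now rewrite !Cmod_pow, Cmod_conj. }
  simpl in HL. rewrite Cmod_mult in HL. nra.
Qed.

(** * Toeplitz forms of sums of squared moduli *)

(** Partial sums of the [i]-th Fourier coefficient of [|f|^2] on the unit circle, where [f] has
    coefficients [a]. *)
Definition autoc (a : nat -> C) (i M : nat) : C :=
  csum (fun m => a (m + i)%nat * Cconj (a m))%C M.

(** AM-GM dominates each term by half of [|a_(m+i)|^2] plus half of [|a_m|^2]. The bound [A] does
    not depend on [i], which later allows summation over a family of functions. *)
Lemma autoc_cv a A :
  (forall n, rsum (fun k => Cmod (a k) ^ 2) n <= A) ->
  forall i, exists g, Ccv (autoc a i) g /\ Cmod g <= A.
Proof.
  intros HA i.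
  set (b := fun m => / 2 * Cmod (a (i + m)%nat) ^ 2 + / 2 * Cmod (a m) ^ 2).
  assert (Hb : forall m, Cmod (a (m + i)%nat * Cconj (a m))%C <= b m).
  { intros m. rewrite Cmod_mult, Cmod_conj. unfold b. rewrite (Nat.add_comm i).
    assert (H := Rmult_le_AMGM (Cmod (a (m + i)%nat)) (Cmod (a m))). lra. }
  assert (HB : forall n, rsum b n <= A).
  { intros n. unfold b. rewrite rsum_plus, !rsum_scal.
    assert (H1 := HA n). assert (H2 := HA (i + n)%nat). rewrite rsum_split in H2.
    assert (0 <= rsum (fun k => Cmod (a k) ^ 2) i)
      by (apply rsum_nonneg; intros; apply Cmod2_nonneg). lra. }
  destruct (csum_abs_cv _ b A Hb HB) as [g Hg].
  exists g. split; [exact Hg|]. now apply csum_cv_le with (2 := HB) (3 := Hg).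
Qed.

(* [rsum (toep G y) N] is the Hermitian Toeplitz form
   [sum_(i,j<N) G_(i-j) y_j conj y_i], with [G_(-k) = conj G_k]. *)
Definition toep (G y : nat -> C) (i : nat) : R :=
  Re (Cconj (y i) * (G 0%nat * y i + 2 * csum (fun j => G (i - j)%nat * y j) i))%C.

Lemma toep_lim (Gs : nat -> nat -> C) G y i :
  (forall k, Ccv (fun K => Gs K k) (G k)) ->
  is_lim_seq (fun K => toep (Gs K) y i) (toep G y i).
Proof.
  intros H. apply Ccv_Re. apply Ccv_scal. apply Ccv_plus.
  - apply Ccv_mult; [apply H|apply Ccv_const].
  - apply Ccv_scal.
    apply (Ccv_csum (fun K j => Gs K (i - j)%nat * y j)%C).
    intros j _. apply Ccv_mult; [apply H|apply Ccv_const].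
Qed.

Lemma toep_plus G H y i :
  toep (fun k => G k + H k)%C y i = toep G y i + toep H y i.
Proof.
  unfold toep. rewrite <- re_plus. f_equal.
  rewrite (csum_ext _ (fun j => G (i - j)%nat * y j + H (i - j)%nat * y j)%C)
    by (intros; ring).
  rewrite csum_plus. ring.
Qed.

(** The [n]-th coefficient of [f] times the polynomial [sum_(j<N) y_j z^j]. Unlike [conv a y], it
    involves only the first [N] entries of [y] for every [n]. *)
Definition shift_comb (a y : nat -> C) (N n : nat) : C :=
  csum (fun j => if Nat.leb j n then (y j * a (n - j)%nat)%C else 0%C) N.

Lemma Cmod2_plus a b :
  Cmod (a + b)%C ^ 2 = Cmod a ^ 2 + Re (Cconj b * b + 2 * (a * Cconj b))%C.
Proof.
  rewrite !Cmod2_alt. destruct a as [a1 a2], b as [b1 b2]. simpl. ring.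
Qed.

(** The new summand [y_N z^N f] only affects coefficients of index [N + m]. Expanding the square
    there yields its own energy and the cross terms with the earlier shifts, which are
    autocorrelations of lag 0 and [N - j]. Stopping at [N + L] makes every one of them a partial sum
    of the same length [L]. *)
Lemma shift_comb_step a y N L :
  rsum (fun n => Cmod (shift_comb a y (S N) n) ^ 2) (N + L)
  = rsum (fun n => Cmod (shift_comb a y N n) ^ 2) (N + L)
    + toep (fun i => autoc a i L) y N.
Proof.
  rewrite !rsum_split.
  rewrite (rsum_ext (fun n => Cmod (shift_comb a y (S N) n) ^ 2)
             (fun n => Cmod (shift_comb a y N n) ^ 2) N).
  2:{ intros n Hn. unfold shift_comb. cbn [csum].
      replace (N <=? n)%nat with false by (symmetry; apply Nat.leb_gt; lia).
      now rewrite Cplus_0_r. }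
  rewrite Rplus_assoc. f_equal.
  rewrite (rsum_ext _ (fun m => Cmod (shift_comb a y N (N + m)%nat) ^ 2 +
    Re (Cconj (y N) * (y N * (a (m + 0)%nat * Cconj (a m))
        + 2 * csum (fun j => y j * (a (m + (N - j))%nat * Cconj (a m))) N))%C)).
  2:{ intros m _. unfold shift_comb. cbn [csum].
      replace (N <=? N + m)%nat with true by (symmetry; apply Nat.leb_le; lia).
      rewrite Cmod2_plus. f_equal. f_equal.
      replace (N + m - N)%nat with m by lia. rewrite Nat.add_0_r, Cmult_conj.
      rewrite (csum_ext (fun j => y j * (a (m + (N - j))%nat * Cconj (a m)))%C
        (fun j => (if (j <=? N + m)%nat then y j * a (N + m - j)%nat else 0) * Cconj (a m))%C).
      - rewrite csum_scal_r. ring.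
      - intros j Hj.
        replace (j <=? N + m)%nat with true by (symmetry; apply Nat.leb_le; lia).
        replace (N + m - j)%nat with (m + (N - j))%nat by lia. ring. }
  rewrite rsum_plus. f_equal. rewrite <- Re_csum. unfold toep. f_equal.
  rewrite csum_scal. f_equal. rewrite csum_plus, !csum_scal. unfold autoc. f_equal.
  - ring.
  - f_equal. rewrite csum_switch. apply csum_ext. intros j _.
    rewrite csum_scal. ring.
Qed.

Lemma shift_comb_conv a y N n : (n < N)%nat -> shift_comb a y N n = conv a y n.
Proof.
  intros Hn. unfold shift_comb, conv. replace N with (S n + (N - S n))%nat by lia.
  rewrite csum_split, (csum_0 _ (N - S n)).
  - rewrite Cplus_0_r. apply csum_ext. intros j Hj.
    replace (j <=? n)%nat with true by (symmetry; apply Nat.leb_le; lia). ring.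
  - intros j _. now replace (S n + j <=? n)%nat with false by (symmetry; apply Nat.leb_gt; lia).
Qed.

(** The Toeplitz form of [|f|^2] at [y] is the integral of [|f|^2 |Y|^2], i.e. the full squared norm
    of [f Y], where [Y] is the polynomial with coefficients [y_0, ..., y_(N-1)]. *)
Lemma toep_autoc_lim a g y N :
  (forall i, Ccv (autoc a i) (g i)) ->
  is_lim_seq (fun M => rsum (fun n => Cmod (shift_comb a y N n) ^ 2) M) (rsum (toep g y) N).
Proof.
  intros Hg. induction N as [|N IH].
  - apply is_lim_seq_ext with (fun _ => 0); [|apply is_lim_seq_const].
    intros M. unfold shift_comb. cbn [csum]. rewrite rsum_const, Cmod_0. ring.
  - apply (is_lim_seq_incr_n _ N) in IH. apply (is_lim_seq_incr_n _ N).
    apply is_lim_seq_ext with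
      (fun L => rsum (fun n => Cmod (shift_comb a y N n) ^ 2) (L + N)
                + toep (fun i => autoc a i L) y N).
    + intros L. now rewrite (Nat.add_comm L), shift_comb_step.
    + apply is_lim_seq_plus'; [exact IH|].
      now apply (toep_lim (fun L i => autoc a i L)).
Qed.

(** The form is the squared norm of all of [f Y], whose first [N] coefficients are those of
    [conv a y]; dropping the others gives the inequality. *)
Lemma toep_autoc_ge a g y N :
  (forall i, Ccv (autoc a i) (g i)) ->
  rsum (fun n => Cmod (conv a y n) ^ 2) N <= rsum (toep g y) N.
Proof.
  intros Hg. assert (L := toep_autoc_lim a g y N Hg).
  apply (is_lim_seq_incr_n _ N) in L. apply (is_lim_seq_ge_const _ _ _ L).
  intros M. apply Rle_trans with (rsum (fun n => Cmod (shift_comb a y N n) ^ 2) N).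
  - right. apply rsum_ext. intros. now rewrite shift_comb_conv.
  - apply rsum_incr; [intros; apply Cmod2_nonneg|lia].
Qed.

Lemma toep_csum (G : nat -> nat -> C) y i K :
  toep (fun k => csum (fun l => G l k) K) y i = rsum (fun l => toep (G l) y i) K.
Proof.
  induction K as [|K IH].
  - unfold toep. cbn [csum rsum]. rewrite csum_0 by (intros; ring).
    replace (Cconj (y i) * (0 * y i + 2 * 0))%C with (RtoC 0) by ring. apply re_RtoC.
  - cbn [csum rsum]. rewrite <- IH. apply (toep_plus (fun k => csum (fun l => G l k) K)).
Qed.

(** [G] is the sequence of Fourier coefficients of [U = sum_k |f_k|^2], obtained by adding the
    limits of the autocorrelations; summability of [A] gives convergence and the bound by [S]. *)
Lemma Toeplitz_majorant (a : nat -> nat -> C) (A : nat -> R) (S : R) :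
  (forall k n, rsum (fun i => Cmod (a k i) ^ 2) n <= A k) ->
  (forall n, rsum A n <= S) ->
  exists G : nat -> C,
    (forall i, Cmod (G i) <= S) /\
    forall k y N, rsum (fun n => Cmod (conv (a k) y n) ^ 2) N <= rsum (toep G y) N.
Proof.
  intros HA HS.
  set (g := fun k i => proj1_sig (constructive_indefinite_description _
                                    (autoc_cv (a k) (A k) (HA k) i))).
  assert (Hg : forall k i, Ccv (autoc (a k) i) (g k i) /\ Cmod (g k i) <= A k)
    by (intros; unfold g; apply proj2_sig).
  assert (HG : forall i, exists l, Ccv (csum (fun k => g k i)) l).
  { intros i. apply csum_abs_cv with A S; [|easy]. intros; apply Hg. }
  set (G := fun i => proj1_sig (constructive_indefinite_description _ (HG i))).
  assert (HG' : forall i, Ccv (csum (fun k => g k i)) (G i))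
    by (intros; unfold G; apply proj2_sig).
  exists G. split.
  { intros i. apply csum_cv_le with (fun k => g k i) A; [|easy|apply HG'].
    intros; apply Hg. }
  intros k y N.
  (* Positivity of each form lets the form of the sum dominate that of a single [|f_k|^2]. *)
  assert (Hpos : forall l, 0 <= rsum (toep (g l) y) N).
  { intros l. eapply Rle_trans; [|apply toep_autoc_ge; intros; apply (Hg l)].
    apply rsum_nonneg. intros; apply Cmod2_nonneg. }
  assert (L : is_lim_seq (fun K => rsum (toep (fun i => csum (fun l => g l i) K) y) N)
                (rsum (toep G y) N)).
  { apply (is_lim_seq_rsum (fun K => toep (fun i => csum (fun l => g l i) K) y)).
    intros i _. now apply (toep_lim (fun K i => csum (fun l => g l i) K)). }
  apply (is_lim_seq_incr_n _ (1 + k)) in L. apply (is_lim_seq_ge_const _ _ _ L).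
  intros K. rewrite (rsum_ext (toep _ y) (fun i => rsum (fun l => toep (g l) y i) (K + (1 + k))))
    by (intros; apply toep_csum).
  rewrite rsum_switch. apply Rle_trans with (rsum (toep (g k) y) N).
  - apply toep_autoc_ge. intros; apply (Hg k).
  - apply (rsum_ge_term (fun l => rsum (toep (g l) y) N)); [easy|lia].
Qed.

(** * The formal reciprocal and the bounded multiplier *)

(** Each coefficient of a reciprocal series depends on all earlier ones, so the recursion carries
    the whole sequence: stage [n] has its final values below index [n] and 0 from there on. *)
Fixpoint conv_inv_aux (F : nat -> C) (n : nat) : nat -> C :=
  match n with
  | O => fun _ => 0%C
  | S m => fun i =>
      if Nat.eqb i m
      then ((cdelta 0 m - csum (fun j => F (m - j)%nat * conv_inv_aux F m j) m)
            * / F 0%nat)%C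
      else conv_inv_aux F m i
  end.

Lemma conv_inv_exists (F : nat -> C) :
  F 0%nat <> 0%C -> exists h, forall n, conv F h n = cdelta 0 n.
Proof.
  intros HF. exists (fun i => conv_inv_aux F (S i) i).
  assert (Hst : forall n i, (i < n)%nat -> conv_inv_aux F n i = conv_inv_aux F (S i) i).
  { induction n as [|n IH]; intros i Hi; [lia|].
    destruct (Nat.eq_dec i n) as [->|Hne]; [easy|].
    rewrite <- IH by lia. cbn [conv_inv_aux].
    apply Nat.eqb_neq in Hne. now rewrite Hne. }
  intros n. unfold conv. cbn [csum]. rewrite Nat.sub_diag.
  rewrite (csum_ext _ (fun j => F (n - j)%nat * conv_inv_aux F n j)%C)
    by (intros j Hj; now rewrite (Hst n j Hj)).
  cbn [conv_inv_aux]. rewrite Nat.eqb_refl. field. easy.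
Qed.

Lemma conv_delta_r x n : conv x (cdelta 0) n = x n.
Proof.
  unfold conv. rewrite (csum_single _ _ 0).
  - rewrite Nat.sub_0_r. unfold cdelta. simpl. ring.
  - lia.
  - intros i _ Hi. unfold cdelta. apply Nat.eqb_neq in Hi. rewrite Hi. ring.
Qed.

(* With [F = 1 + G_0 + 2 sum_(i>0) G_i z^i], where [Re F >= 1 + |f_k|^2] on the unit
   circle in the sense of Toeplitz forms, [h = 1/F] works. *)
Lemma outer_bound (a : nat -> nat -> C) (A : nat -> R) (S : R) :
  (forall k n, rsum (fun i => Cmod (a k i) ^ 2) n <= A k) ->
  (forall n, rsum A n <= S) ->
  exists hc h, is_pseries_on_D hc h /\ (forall z, inD z -> h z <> 0%C) /\
    forall k f z, is_pseries_on_D (a k) f -> inD z -> Cmod (h z * f z)%C <= 1.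
Proof.
  intros HA HS. destruct (Toeplitz_majorant a A S HA HS) as [G [HG Ht]].
  set (F := fun i => match i with O => (1 + G 0%nat)%C | _ => (2 * G i)%C end).
  assert (HF : forall y i,
    Re (Cconj (y i) * conv F y i)%C = Cmod (y i) ^ 2 + toep G y i).
  { intros y i. unfold conv, toep. cbn [csum]. rewrite Nat.sub_diag.
    rewrite (csum_ext _ (fun j => 2 * (G (i - j)%nat * y j))%C).
    2:{ intros j Hj. unfold F. destruct (i - j)%nat eqn:E; [lia|]. ring. }
    rewrite csum_scal. set (s := csum _ i).
    replace (Cconj (y i) * (2 * s + F 0%nat * y i))%C
      with (y i * Cconj (y i) + Cconj (y i) * (G 0%nat * y i + 2 * s))%C
      by (unfold F; ring).
    now rewrite re_plus, <- Cmod2_conj, re_RtoC. }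
  (* The form of size 1 at [y = 1] is [Re G_0 >= 0], so [Re F_0 >= 1]. *)
  assert (HF0 : F 0%nat <> 0%C).
  { intros E. assert (H := HF (fun _ => 1%C) 0%nat).
    assert (H1 := Ht 0%nat (fun _ => 1%C) 1%nat). cbn [rsum] in H1.
    unfold conv in H. cbn [csum] in H. simpl (0 - 0)%nat in H. rewrite E in H.
    rewrite Cmod_1 in H.
    replace (Cconj 1 * (0 + 0 * 1))%C with (RtoC 0) in H by ring. rewrite re_RtoC in H.
    assert (H2 := Cmod2_nonneg (conv (a 0%nat) (fun _ => 1%C) 0)). lra. }
  destruct (conv_inv_exists F HF0) as [hc Hh].
  (* An energy estimate: [y = hc x] solves [F y = x], so pairing with [y] gives [|y|^2 + form(y) =
     Re <x, y> <= |y|^2 / 2 + |x|^2 / 2] on the first [N] coordinates. As the form dominates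
     [|f_k y|^2], convolution with [hc] and with [a k] after [hc] are both contractive. *)
  assert (Hmain : forall k x N,
    rsum (fun n => Cmod (conv hc x n) ^ 2) N <= rsum (fun n => Cmod (x n) ^ 2) N /\
    rsum (fun n => Cmod (conv (a k) (conv hc x) n) ^ 2) N <= rsum (fun n => Cmod (x n) ^ 2) N).
  { intros k x N. set (y := conv hc x).
    assert (Ey : forall n, conv F y n = x n).
    { intros n. unfold y. rewrite conv_assoc.
      rewrite (conv_ext _ (cdelta 0) x x) by easy. apply conv_delta_l. }
    assert (H1 := Ht k y N).
    assert (H2 : rsum (fun n => Cmod (y n) ^ 2) N + rsum (toep G y) N
      <= / 2 * rsum (fun n => Cmod (y n) ^ 2) N + / 2 * rsum (fun n => Cmod (x n) ^ 2) N).
    { rewrite <- !rsum_scal, <- !rsum_plus. apply rsum_le. intros n _.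
      rewrite <- HF, Ey.
      eapply Rle_trans; [apply Rle_abs|]. eapply Rle_trans; [apply re_le_Cmod|].
      rewrite Cmod_mult, Cmod_conj.
      assert (H := Rmult_le_AMGM (Cmod (y n)) (Cmod (x n))). lra. }
    assert (0 <= rsum (fun n => Cmod (conv (a k) y n) ^ 2) N)
      by (apply rsum_nonneg; intros; apply Cmod2_nonneg).
    assert (0 <= rsum (fun n => Cmod (y n) ^ 2) N)
      by (apply rsum_nonneg; intros; apply Cmod2_nonneg).
    split; lra. }
  (* Contractivity applied to the constant series 1 bounds the norm of [hc] itself by 1. *)
  destruct (pseries_l2_exists hc 1) as [h Hph].
  { intros N. destruct (Hmain 0%nat (cdelta 0) N) as [H _].
    eapply Rle_trans; [|apply (rsum_Cmod2_delta 0 N)].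
    eapply Rle_trans; [|apply H]. right. apply rsum_ext. intros.
    now rewrite conv_delta_r. }
  (* Since the coefficients of [F] are bounded, [F] converges in the disk, and the formal identity
     [F h = 1] becomes pointwise; hence [h] has no zeros. *)
  destruct (pseries_bounded_exists F (1 + 2 * S)) as [f Hpf].
  { intros n. assert (H := HG n). assert (H0 := Cmod_ge_0 (G n)).
    destruct n as [|n]; unfold F.
    - eapply Rle_trans; [apply Cmod_triangle|]. rewrite Cmod_1. lra.
    - rewrite Cmod_mult, Cmod_R, Rabs_pos_eq; lra. }
  exists hc, h. split; [easy|]. split.
  - intros z Hz E.
    assert (H1 := pseries_Ccv _ _ z (pseries_mult F hc f h Hpf Hph) Hz).
    assert (H2 := pseries_Ccv _ _ z
      (pseries_ext _ (conv F hc) _ _ (fun n => eq_sym (Hh n)) (fun z _ => eq_refl)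
        (pseries_monomial 0)) Hz).
    assert (H3 := Ccv_unique _ _ _ H1 H2). cbv beta in H3. rewrite E in H3.
    replace (f z * 0)%C with (0 : C) in H3 by ring. simpl in H3.
    apply (f_equal fst) in H3. simpl in H3. lra.
  - intros k fk z Hk Hz. rewrite Cmult_comm.
    apply (contractive_conv_bound (conv (a k) hc) (fun z => fk z * h z)%C); try easy.
    + intros x N. destruct (Hmain k x N) as [_ H]. eapply Rle_trans; [|apply H].
      right. apply rsum_ext. intros. now rewrite conv_assoc.
    + now apply pseries_mult.
Qed.

(** * Approximation numbers and the decay of [T (z^j)] *)

Definition cdot (v u : nat -> C) (K : nat) : C := csum (fun k => v k * Cconj (u k))%C K.

(** Orthogonal projection along [u] in the space of the first [K] coordinates. *)
Definition cproj (u : nat -> C) (K : nat) (v : nat -> C) (k : nat) : C :=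
  (v k - RtoC (/ rsum (fun k => Cmod (u k) ^ 2)%R K) * cdot v u K * u k)%C.

Lemma Cmod2_minus_scal v t u :
  Cmod (v - t * u)%C ^ 2
  = Cmod v ^ 2 + (- 2 * Re (Cconj t * (v * Cconj u))%C + Cmod t ^ 2 * Cmod u ^ 2).
Proof.
  rewrite !Cmod2_alt. destruct v as [v1 v2], u as [u1 u2], t as [t1 t2].
  unfold Cconj, Cmult, Cminus, Cplus, Copp, Re, Im. cbn [fst snd]. ring.
Qed.

Lemma cproj_Pythagoras u K v :
  rsum (fun k => Cmod (u k) ^ 2) K <> 0 ->
  rsum (fun k => Cmod (v k) ^ 2) K
  = rsum (fun k => Cmod (cproj u K v k) ^ 2) K
    + / rsum (fun k => Cmod (u k) ^ 2) K * Cmod (cdot v u K) ^ 2.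
Proof.
  intros HU. unfold cproj. set (U := rsum (fun k => Cmod (u k) ^ 2) K) in *.
  set (d := cdot v u K). assert (HV : / U * U = 1) by now apply Rinv_l.
  set (V := / U) in *.
  rewrite (rsum_ext (fun k => Cmod (v k - V * d * u k)%C ^ 2)
    (fun k => Cmod (v k) ^ 2 + (- 2 * Re (Cconj (V * d) * (v k * Cconj (u k)))%C
       + Cmod (V * d)%C ^ 2 * Cmod (u k) ^ 2)))
    by (intros; apply Cmod2_minus_scal).
  rewrite !rsum_plus, !rsum_scal. fold U.
  rewrite <- Re_csum, csum_scal. fold (cdot v u K). fold d.
  replace (Cconj (V * d) * d)%C with (RtoC (V * Cmod d ^ 2)).
  2:{ rewrite RtoC_mult, Cmod2_conj, Cmult_conj.
      replace (Cconj (RtoC V)) with (RtoC V)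
        by (unfold Cconj, RtoC; simpl; now rewrite Ropp_0).
      ring. }
  rewrite re_RtoC, Cmod2_mult, Cmod_R, RPow_abs, Rabs_pos_eq by apply pow2_ge_0.
  replace (V ^ 2 * Cmod d ^ 2 * U) with (V * U * (V * Cmod d ^ 2)) by ring.
  rewrite HV. ring.
Qed.

Lemma cdot_csum (x : nat -> C) (c : nat -> nat -> C) u J K :
  cdot (fun k => csum (fun j => x j * c j k)%C J) u K
  = csum (fun j => x j * cdot (c j) u K)%C J.
Proof.
  unfold cdot.
  rewrite (csum_ext _ (fun k => csum (fun j => x j * (c j k * Cconj (u k)))%C J)).
  2:{ intros. rewrite <- csum_scal_r. apply csum_ext. intros. ring. }
  rewrite csum_switch. apply csum_ext. intros. apply csum_scal.
Qed.

Lemma cproj_csum (x : nat -> C) (c : nat -> nat -> C) u J K k :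
  cproj u K (fun k => csum (fun j => x j * c j k)%C J) k
  = csum (fun j => x j * cproj u K (c j) k)%C J.
Proof.
  unfold cproj. rewrite cdot_csum. set (U := RtoC (/ _)).
  rewrite (csum_ext (fun j => x j * (c j k - U * cdot (c j) u K * u k))%C
    (fun j => x j * c j k - (U * u k) * (x j * cdot (c j) u K))%C) by (intros; ring).
  rewrite csum_minus, csum_scal. ring.
Qed.

Lemma cproj_ext u K v w k :
  (forall i, (i < K)%nat -> v i = w i) -> (k < K)%nat -> cproj u K v k = cproj u K w k.
Proof.
  intros H Hk. unfold cproj. rewrite (H k Hk). do 3 f_equal.
  apply csum_ext. intros. now rewrite H.
Qed.

Lemma rsum_eq_0 (f : nat -> R) n i :
  (forall j, 0 <= f j) -> rsum f n = 0 -> (i < n)%nat -> f i = 0.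
Proof. intros Hf H Hi. assert (H1 := rsum_ge_term f n i Hf Hi). specialize (Hf i). lra. Qed.

(* The squared Hilbert-Schmidt norm of an operator is at most its rank times its
   squared norm; induction on the rank, projecting away one vector of the range. *)
Lemma finite_rank_trace n : forall (c G lam : nat -> nat -> C) B J K,
  0 <= B ->
  (forall j k, (j < J)%nat -> (k < K)%nat -> c j k = csum (fun i => lam j i * G i k)%C n) ->
  (forall x : nat -> C,
     rsum (fun k => Cmod (csum (fun j => x j * c j k)%C J) ^ 2) K
     <= B * rsum (fun j => Cmod (x j) ^ 2) J) ->
  rsum (fun j => rsum (fun k => Cmod (c j k) ^ 2) K) J <= INR n * B.
Proof.
  induction n as [|n IH]; intros c G lam B J K HB Hc Hx.
  - right. rewrite (rsum_ext _ (fun _ => 0)), rsum_const; [simpl; ring|].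
    intros j Hj. rewrite (rsum_ext _ (fun _ => 0)), rsum_const; [ring|].
    intros k Hk. rewrite Hc by easy. simpl csum. rewrite Cmod_0. ring.
  - set (u := G n). set (U := rsum (fun k => Cmod (u k) ^ 2) K).
    rewrite S_INR.
    destruct (Req_dec U 0) as [HU|HU].
    + apply Rle_trans with (INR n * B); [|lra].
      apply (IH c G lam B J K HB); [|easy].
      intros j k Hj Hk. rewrite Hc by easy. cbn [csum].
      replace (G n k) with (0 : C); [ring|]. symmetry. apply Cmod2_eq_0. right.
      apply (rsum_eq_0 (fun k => Cmod (u k) ^ 2) K); [intros; apply Cmod2_nonneg|easy|easy].
    + assert (HU0 : 0 < U).
      { assert (0 <= U) by (apply rsum_nonneg; intros; apply Cmod2_nonneg). lra. }
      assert (HiU : 0 < / U) by now apply Rinv_0_lt_compat.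
      assert (IH1 : rsum (fun j => rsum (fun k => Cmod (cproj u K (c j) k) ^ 2) K) J
                    <= INR n * B).
      { apply (IH _ (fun i => cproj u K (G i)) lam B J K HB).
        - intros j k Hj Hk.
          rewrite (cproj_ext u K (c j) (fun k => csum (fun i => lam j i * G i k)%C (S n)))
            by (intros; auto).
          rewrite cproj_csum. cbn [csum].
          (* The vector [G n] is [u] and projects to 0, so the projected rows are spanned by [n]
             vectors. *)
          replace (cproj u K (G n) k) with (0 : C); [ring|].
          fold u. unfold cproj. fold U. replace (cdot u u K) with (RtoC U).
          + rewrite <- RtoC_mult.
            rewrite Rinv_l by easy. ring.
          + unfold U, cdot. rewrite RtoC_rsum. apply csum_ext. intros. apply Cmod2_conj.
        - intros x. eapply Rle_trans; [|apply Hx].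
          rewrite (cproj_Pythagoras u K (fun k => csum (fun j => x j * c j k)%C J)) by easy.
          fold U.
          rewrite (rsum_ext (fun k => Cmod (csum (fun j => x j * cproj u K (c j) k)%C J) ^ 2)
            (fun k => Cmod (cproj u K (fun k => csum (fun j => x j * c j k)%C J) k) ^ 2))
            by (intros; now rewrite cproj_csum).
          match goal with |- _ <= _ + / U * Cmod ?d ^ 2 =>
            assert (H := Cmod2_nonneg d) end.
          assert (0 <= / U * Cmod (cdot (fun k => csum (fun j => x j * c j k)%C J) u K) ^ 2)
            by (apply Rmult_le_pos; lra).
          lra. }
      set (P := rsum (fun j => Cmod (cdot (c j) u K) ^ 2) J).
      assert (HP : / U * P <= B).
      { assert (P0 : 0 <= P) by (apply rsum_nonneg; intros; apply Cmod2_nonneg).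
        (* With this test vector the combination of the [c j] has inner product exactly [P] with
           [u], so the norm bound reads [P^2 / U <= B P]: the direction [u] carries at most one
           share [B] of the trace. *)
        specialize (Hx (fun j => Cconj (cdot (c j) u K))).
        rewrite (rsum_ext (fun j => Cmod (Cconj (cdot (c j) u K)) ^ 2)
          (fun j => Cmod (cdot (c j) u K) ^ 2)) in Hx by (intros; now rewrite Cmod_conj).
        fold P in Hx.
        rewrite (cproj_Pythagoras u K) in Hx by easy. fold U in Hx.
        rewrite cdot_csum in Hx.
        replace (csum (fun j => Cconj (cdot (c j) u K) * cdot (c j) u K)%C J)
          with (RtoC P) in Hx.
        2:{ unfold P. rewrite RtoC_rsum. apply csum_ext. intros.
            rewrite Cmod2_conj. ring. }
        rewrite Cmod_R, Rabs_pos_eq in Hx by easy.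
        match type of Hx with ?q + _ <= _ => assert (0 <= q)
          by (apply rsum_nonneg; intros; apply Cmod2_nonneg) end.
        destruct (Req_dec P 0) as [E|E]; [rewrite E; lra|].
        apply Rmult_le_reg_r with P; [lra|]. nra. }
      rewrite (rsum_ext _ (fun j => rsum (fun k => Cmod (cproj u K (c j) k) ^ 2) K
         + / U * Cmod (cdot (c j) u K) ^ 2)) by (intros; now apply cproj_Pythagoras).
      rewrite rsum_plus, rsum_scal. fold P. lra.
Qed.

Lemma linear_H2_lincomb T lam g n z :
  linear_H2 T -> (forall i, (i < n)%nat -> H2 (g i)) -> inD z ->
  T (lincomb lam g n) z = lincomb lam (fun i => T (g i)) n z.
Proof.
  intros [Hp Hs]. revert z. induction n as [|n IH]; intros z Hg Hz.
  - assert (E : lincomb lam g 0 = (fun x => RtoC 0 * (fun _ => RtoC 0) x)%C).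
    { apply functional_extensionality. intros x. simpl. ring. }
    rewrite E, Hs by (try easy; exists (fun _ => 0%C); apply H2_coeffs_0).
    simpl. ring.
  - change (lincomb lam g (S n)) with (fun x => lincomb lam g n x + lam n * g n x)%C.
    assert (Hn : H2 (g n)) by (apply Hg; lia).
    assert (H2 (lincomb lam g n)).
    { destruct n as [|n']; [exists (fun _ => 0%C); apply H2_coeffs_0|].
      set (c := fun i => epsilon (inhabits (fun _ : nat => RtoC 0))
                           (fun a => is_H2_coeffs a (g i))).
      eexists. apply (H2_coeffs_lincomb lam c). intros i Hi. unfold c.
      apply epsilon_spec. apply Hg. lia. }
    rewrite (Hp (lincomb lam g n) (fun x => lam n * g n x)%C); [|easy| |easy].
    + rewrite (Hs (lam n) (g n)) by easy. rewrite IH; [easy| |easy].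
      intros. apply Hg. lia.
    + destruct Hn as [a Ha]. eexists. apply (H2_coeffs_scal (lam n) _ _ Ha).
Qed.

Lemma H2_coeffs_minus a b f g :
  is_H2_coeffs a f -> is_H2_coeffs b g ->
  is_H2_coeffs (fun n => a n - b n)%C (fun z => f z - g z)%C.
Proof.
  intros Hf Hg.
  apply H2_coeffs_ext with (fun n => a n + (-(1)) * b n)%C (fun z => f z + (-(1)) * g z)%C.
  - intros; ring.
  - intros; ring.
  - apply H2_coeffs_plus; [easy|now apply H2_coeffs_scal].
Qed.

Lemma l2sum_le_diff a b f g :
  is_H2_coeffs a f -> is_H2_coeffs b g ->
  l2sum a <= 2 * l2sum b + 2 * l2sum (fun k => a k - b k)%C /\
  l2sum b <= 2 * l2sum a + 2 * l2sum (fun k => a k - b k)%C.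
Proof.
  intros Hf Hg. destruct (H2_coeffs_minus _ _ _ _ Hf Hg) as [Hd _].
  destruct Hf as [Ha _], Hg as [Hb _].
  split; apply l2sum_le; intros n;
    assert (H1 := l2sum_ge a n Ha); assert (H2 := l2sum_ge b n Hb);
    assert (H3 := l2sum_ge _ n Hd).
  - apply Rle_trans with (rsum (fun k => 2 * Cmod (b k) ^ 2 + 2 * Cmod (a k - b k)%C ^ 2) n).
    + apply rsum_le. intros k _. replace (a k) with (b k + (a k - b k))%C at 1 by ring.
      apply Cmod2_plus_le.
    + rewrite rsum_plus, !rsum_scal. lra.
  - apply Rle_trans with (rsum (fun k => 2 * Cmod (a k) ^ 2 + 2 * Cmod (a k - b k)%C ^ 2) n).
    + apply rsum_le. intros k _. replace (b k) with (a k + - (a k - b k))%C at 1 by ring.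
      rewrite <- (Cmod_opp (a k - b k)%C). apply Cmod2_plus_le.
    + rewrite rsum_plus, !rsum_scal. lra.
Qed.

(** * Approximation numbers as infima *)

(** The lower bound 0 and the member [e0] exclude infinite values of the infimum, which [real] would
    silently turn into 0. The infimum need not be attained, whence the slack [d]. *)
Lemma Glb_Rbar_nonneg (E : R -> Prop) e0 :
  (forall e, E e -> 0 <= e) -> E e0 ->
  0 <= real (Glb_Rbar E) <= e0 /\
  forall d, 0 < d -> exists e, E e /\ e < real (Glb_Rbar E) + d.
Proof.
  intros H0 He. destruct (Glb_Rbar_correct E) as [Hlb Hglb].
  assert (H1 := Hlb e0 He).
  assert (H2 : Rbar_le 0 (Glb_Rbar E)) by (apply Hglb; intros e; apply H0).
  destruct (Glb_Rbar E) as [g| |]; simpl in *; try easy.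
  split; [easy|]. intros d Hd. apply NNPP. intros Hno.
  assert (H3 : Rbar_le (Finite (g + d)) g).
  { apply Hglb. intros e Ee. simpl. apply Rnot_lt_le. intros Hlt. apply Hno. now exists e. }
  simpl in H3. lra.
Qed.

Lemma rank_le_zero n : rank_le_H2 (fun _ _ => 0%C) n.
Proof.
  split; [|split].
  - split; intros; ring.
  - exists 0. intros a f [Ha _]. exists (fun _ => 0%C). split; [apply H2_coeffs_0|].
    replace (0 ^ 2 * l2sum a) with 0 by ring. apply l2sum_le.
    intros m. rewrite rsum_const, Cmod_0. lra.
  - exists (fun _ _ => 0%C). split.
    + intros. exists (fun _ => 0%C). apply H2_coeffs_0.
    + intros f _. exists (fun _ => 0%C). intros z _. rewrite lincomb_csum.
      symmetry. apply csum_0. intros. ring.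
Qed.

(* The zero operator competes in the infimum, so that it is finite. *)
Lemma sing_num_approx T n d :
  bounded_H2 T -> 0 < d ->
  exists e F, 0 <= e /\ e < sing_num T n + d /\ rank_le_H2 F n /\ opnorm_diff_le T F e.
Proof.
  intros [M HM] Hd.
  destruct (Glb_Rbar_nonneg (fun e => 0 <= e /\ exists F, rank_le_H2 F n /\ opnorm_diff_le T F e)
             (Rabs M)) as [_ H].
  - now intros e [He _].
  - split; [apply Rabs_pos|]. exists (fun _ _ => 0%C). split; [apply rank_le_zero|].
    intros a f b c Ha Hb Hc. destruct (HM a f Ha) as [b' [Hb' Hl]].
    rewrite RPow_abs, Rabs_pos_eq by apply pow2_ge_0.
    eapply Rle_trans; [|apply Hl]. right. apply l2sum_ext. intros k.
    rewrite (pseries_coeffs_unique c (fun _ => 0%C) _ _ (proj2 Hc) (proj2 H2_coeffs_0))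
      by easy.
    rewrite (pseries_coeffs_unique b b' _ _ (proj2 Hb) (proj2 Hb')) by easy. ring.
  - destruct (H d Hd) as [e [[He [F HF]] Hlt]]. exists e, F. easy.
Qed.

Lemma sing_num_le T n e F :
  0 <= e -> rank_le_H2 F n -> opnorm_diff_le T F e -> sing_num T n <= e.
Proof.
  intros He HF Ho. unfold sing_num.
  apply (Glb_Rbar_nonneg (fun e => 0 <= e /\ exists F, rank_le_H2 F n /\ opnorm_diff_le T F e) e).
  - now intros e' [He' _].
  - split; [easy|]. now exists F.
Qed.

Lemma rsum_truncated_le (x : nat -> C) J n :
  rsum (fun k => Cmod (csum (fun j => x j * cdelta j k)%C J) ^ 2) n
  <= rsum (fun j => Cmod (x j) ^ 2) J.
Proof.
  apply Rle_trans with (rsum (fun k => Cmod (csum (fun j => x j * cdelta j k)%C J) ^ 2) (J + n)).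
  { apply rsum_incr; [intros; apply Cmod2_nonneg|lia]. }
  rewrite rsum_split, (rsum_ext (fun i => Cmod (csum _ J) ^ 2) (fun _ => 0) n), rsum_const.
  - right. rewrite Rmult_0_r, Rplus_0_r. apply rsum_ext. intros k Hk.
    rewrite (csum_single _ _ k Hk).
    + unfold cdelta. rewrite Nat.eqb_refl, Cmult_1_r. easy.
    + intros i _ Hi. unfold cdelta.
      replace (k =? i)%nat with false by (symmetry; apply Nat.eqb_neq; lia). ring.
  - intros i _. rewrite csum_0, Cmod_0; [ring|]. intros j Hj. unfold cdelta.
    replace (J + i =? j)%nat with false by (symmetry; apply Nat.eqb_neq; lia). ring.
Qed.

(** The trace bound limits the sum of the squared norms of [F (z^j)] over [j < J]; some [j] is at
    most average, and replacing [F] by [T] there costs an error [e]. *)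
Lemma finite_rank_approx_decay T M F e n J :
  (forall a f, is_H2_coeffs a f ->
     exists b, is_H2_coeffs b (T f) /\ l2sum b <= M ^ 2 * l2sum a) ->
  rank_le_H2 F n -> opnorm_diff_le T F e -> (0 < J)%nat ->
  exists j b, (j < J)%nat /\ is_H2_coeffs b (T (fun z => z ^ j)%C) /\
    l2sum b <= 2 * (INR n * (2 * M ^ 2 + 2 * e ^ 2) / INR J) + 2 * e ^ 2.
Proof.
  intros HM [Flin [[MF HMF] [g [Hg Hspan]]]] Hop HJ.
  set (m := fun j => fun z : C => (z ^ j)%C).
  assert (Hm : forall j, H2 (m j)) by (intros j; eexists; apply H2_coeffs_monomial).
  assert (Hc : forall j, exists c, is_H2_coeffs c (F (m j))).
  { intros j. destruct (HMF _ _ (H2_coeffs_monomial j)) as [c [H _]]. now exists c. }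
  set (c := fun j => proj1_sig (constructive_indefinite_description _ (Hc j))).
  assert (Hc' : forall j, is_H2_coeffs (c j) (F (m j)))
    by (intros; unfold c; apply proj2_sig).
  set (G := fun i => epsilon (inhabits (fun _ : nat => RtoC 0))
                       (fun a => is_H2_coeffs a (g i))).
  assert (HG : forall i, (i < n)%nat -> is_H2_coeffs (G i) (g i))
    by (intros i Hi; unfold G; apply epsilon_spec; now apply Hg).
  set (lam := fun j => proj1_sig (constructive_indefinite_description _ (Hspan (m j) (Hm j)))).
  assert (Hlam : forall j z, inD z -> F (m j) z = lincomb (lam j) g n z)
    by (intros j; unfold lam; apply proj2_sig).
  assert (Hcl : forall j k, c j k = csum (fun i => lam j i * G i k)%C n).
  { intros j. apply (pseries_coeffs_unique _ _ _ _ (proj2 (Hc' j))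
      (proj2 (H2_coeffs_lincomb (lam j) G g n HG))). apply Hlam. }
  (* A bound for the squared norm of [F], since [F] differs from [T] by at most [e]. *)
  set (B := 2 * M ^ 2 + 2 * e ^ 2).
  assert (HB : 0 <= B) by (unfold B; assert (H1 := pow2_ge_0 M); assert (H2 := pow2_ge_0 e); lra).
  assert (Htr : forall K, rsum (fun j => rsum (fun k => Cmod (c j k) ^ 2) K) J <= INR n * B).
  { intros K. apply (finite_rank_trace n c G lam B J K HB); [intros; apply Hcl|].
    intros x.
    assert (Ha := H2_coeffs_lincomb x cdelta m J (fun i _ => H2_coeffs_monomial i)).
    destruct (HM _ _ Ha) as [b [Hb Hbl]].
    assert (HFc : is_H2_coeffs (fun k => csum (fun j => x j * c j k)%C J) (F (lincomb x m J))).
    { apply (H2_coeffs_ext (fun k => csum (fun j => x j * c j k)%C J) _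
        (lincomb x (fun j => F (m j)) J) _); [easy| |].
      - intros z Hz. symmetry. now apply linear_H2_lincomb.
      - apply H2_coeffs_lincomb. intros; apply Hc'. }
    assert (H1 := Hop _ _ _ _ Ha Hb HFc).
    destruct (l2sum_le_diff _ _ _ _ Hb HFc) as [_ H2].
    assert (H3 := l2sum_ge _ K (proj1 HFc)).
    set (la := l2sum (fun k => csum (fun i => x i * cdelta i k)%C J)) in *.
    assert (H4 : la <= rsum (fun j => Cmod (x j) ^ 2) J)
      by (apply l2sum_le; intros; apply rsum_truncated_le).
    apply Rle_trans with (B * la); [|now apply Rmult_le_compat_l].
    unfold B. lra. }
  assert (Htot : rsum (fun j => l2sum (c j)) J <= INR n * B).
  { apply (is_lim_seq_le_const (fun K => rsum (fun j => rsum (fun k => Cmod (c j k) ^ 2) K) J));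
      [|easy].
    apply (is_lim_seq_rsum (fun K j => rsum (fun k => Cmod (c j k) ^ 2) K)).
    intros j _. apply is_series_rsum. apply Series_correct. apply (Hc' j). }
  destruct (rsum_pigeonhole _ J _ HJ Htot) as [j [Hj Hjl]].
  destruct (HM _ _ (H2_coeffs_monomial j)) as [b [Hb _]].
  exists j, b. split; [easy|]. split; [easy|].
  assert (H1 := Hop _ _ _ _ (H2_coeffs_monomial j) Hb (Hc' j)).
  destruct (l2sum_le_diff _ _ _ _ Hb (Hc' j)) as [H2 _].
  assert (H3 : l2sum (cdelta j) <= 1) by (apply l2sum_le; apply rsum_Cmod2_delta).
  assert (H4 : e ^ 2 * l2sum (cdelta j) <= e ^ 2 * 1)
    by (apply Rmult_le_compat_l; [apply pow2_ge_0|easy]).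
  fold B. lra.
Qed.

Lemma rpow_nonneg x p : 0 <= rpow x p.
Proof. unfold rpow. destruct (Rle_dec x 0); [lra|]. left. apply exp_pos. Qed.

Lemma INR_pow2 k : INR (2 ^ k) = 2 ^ k.
Proof. rewrite pow_INR. now replace (INR 2) with 2 by (simpl; lra). Qed.

(** Among the first [2^k] terms of the convergent series one is at most [S0 / 2^k]; taking [p]-th
    roots gives the ratio [th = 2^(-1/p)]. *)
Lemma Schatten_sing_num_decay p T :
  0 < p -> Schatten p T ->
  exists C0 th, 0 < C0 /\ 0 < th < 1 /\
    forall k, exists n, (n < 2 ^ k)%nat /\ sing_num T n <= C0 * th ^ k.
Proof.
  intros Hp [_ [_ Hs]].
  set (S0 := Series (fun n => rpow (sing_num T n) p)).
  assert (HS : forall n, rsum (fun n => rpow (sing_num T n) p) n <= S0)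
    by (intros; apply rsum_le_Series; [intros; apply rpow_nonneg|easy]).
  assert (S00 : 0 <= S0) by (specialize (HS 0%nat); simpl in HS; lra).
  set (th := Rpower (/ 2) (/ p)).
  assert (Hip : 0 < / p) by now apply Rinv_0_lt_compat.
  (* [S0 + 1] rather than [S0], as the base of [Rpower] must be positive. *)
  exists (Rpower (S0 + 1) (/ p)), th. split; [apply exp_pos|]. split.
  - split; [apply exp_pos|]. unfold th, Rpower. rewrite <- exp_0. apply exp_increasing.
    assert (ln (/ 2) < 0) by (rewrite <- ln_1; apply ln_increasing; lra). nra.
  - intros k.
    assert (H2k : 0 < 2 ^ k) by (apply pow_lt; lra).
    destruct (rsum_pigeonhole _ (2 ^ k) _ ltac:(apply Nat.neq_0_lt_0, Nat.pow_nonzero; lia)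
      (HS (2 ^ k)%nat)) as [n [Hn Hle]].
    exists n. split; [easy|]. rewrite INR_pow2 in Hle. unfold rpow in Hle.
    destruct (Rle_dec (sing_num T n) 0) as [H0|H0].
    + eapply Rle_trans; [apply H0|]. apply Rmult_le_pos; [left; apply exp_pos|].
      apply pow_le. left. apply exp_pos.
    + assert (Hpos : 0 < sing_num T n) by lra.
      replace (sing_num T n) with (Rpower (Rpower (sing_num T n) p) (/ p)).
      2:{ rewrite Rpower_mult, Rinv_r by lra. now apply Rpower_1. }
      replace (Rpower (S0 + 1) (/ p) * th ^ k) with (Rpower ((S0 + 1) * (/ 2) ^ k) (/ p)).
      2:{ rewrite <- (Rpower_mult_distr (S0 + 1)) by (try apply pow_lt; lra).
          f_equal. unfold th. rewrite <- (Rpower_pow k (/ 2)) by lra.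
          rewrite <- (Rpower_pow k) by apply exp_pos.
          rewrite !Rpower_mult. f_equal. ring. }
      apply Rle_Rpower_l; [lra|]. split; [apply exp_pos|].
      eapply Rle_trans; [apply Hle|]. unfold Rdiv. rewrite pow_inv.
      apply Rmult_le_compat_r; [left; now apply Rinv_0_lt_compat|lra].
Qed.

Lemma Schatten_monomial_decay p T :
  0 < p -> Schatten p T ->
  exists C0 s, 0 <= C0 /\ 0 < s < 1 /\
    forall k, exists j b, (j < 4 ^ k)%nat /\ is_H2_coeffs b (T (fun z => z ^ j)%C) /\
      l2sum b <= C0 * (s ^ 2) ^ k.
Proof.
  intros Hp HT. destruct (Schatten_sing_num_decay p T Hp HT) as [C1 [th [HC1 [Hth Hs]]]].
  destruct HT as [_ [Hb _]]. assert (Hb' := Hb). destruct Hb' as [M HM].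
  (* The extra 1 covers the slack [th^k] in the choice of the approximant. The ratio [s^2] must
     dominate [th^2], from the approximation error, and [1/2], from the rank divided by [4^k]; [3/4]
     suffices since [9/16 >= 1/2]. *)
  set (C2 := C1 + 1). set (s := Rmax th (3 / 4)).
  assert (Hs1 : 0 < s < 1).
  { unfold s. split; [eapply Rlt_le_trans; [|apply Rmax_r]; lra|].
    apply Rmax_lub_lt; lra. }
  assert (HM2 := pow2_ge_0 M). assert (HC2 := pow2_ge_0 C2).
  exists (2 * (2 * M ^ 2 + 2 * C2 ^ 2) + 2 * C2 ^ 2), s.
  split; [lra|]. split; [easy|]. intros k.
  destruct (Hs k) as [n [Hn Hsn]].
  assert (Htk : 0 < th ^ k) by (apply pow_lt; lra).
  destruct (sing_num_approx T n (th ^ k) Hb Htk) as [e [F [He [Hlt [HF Hop]]]]].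
  assert (Hek : e <= C2 * th ^ k) by (unfold C2; lra).
  destruct (finite_rank_approx_decay T M F e n (4 ^ k) HM HF Hop) as [j [b [Hj [Hbj Hbl]]]].
  { apply Nat.neq_0_lt_0, Nat.pow_nonzero; lia. }
  exists j, b. split; [easy|]. split; [easy|].
  eapply Rle_trans; [apply Hbl|].
  set (q := (s ^ 2) ^ k).
  assert (Ht1 : th ^ k <= 1) by (rewrite <- (pow1 k); apply pow_incr; lra).
  assert (He1 : e ^ 2 <= C2 ^ 2 * q).
  { apply Rle_trans with ((C2 * th ^ k) ^ 2); [apply pow_incr; lra|].
    rewrite Rpow_mult_distr. apply Rmult_le_compat_l; [easy|]. unfold q.
    rewrite <- !pow_mult, Nat.mul_comm. apply pow_incr. split; [lra|apply Rmax_l]. }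
  assert (He2 : e ^ 2 <= C2 ^ 2).
  { apply pow_incr. split; [easy|]. assert (0 < C2) by (unfold C2; lra). nra. }
  assert (Hq : INR n / INR (4 ^ k) <= q).
  { apply Rle_trans with ((/ 2) ^ k).
    - replace (4 ^ k)%nat with (2 ^ k * 2 ^ k)%nat by now rewrite <- Nat.pow_mul_l.
      rewrite mult_INR, INR_pow2.
      assert (H2k : 0 < 2 ^ k) by (apply pow_lt; lra).
      apply lt_INR in Hn. rewrite INR_pow2 in Hn.
      apply Rmult_le_reg_r with (2 ^ k * 2 ^ k); [nra|].
      unfold Rdiv. rewrite Rmult_assoc, Rinv_l by nra.
      rewrite pow_inv, <- Rmult_assoc, Rinv_l by lra. lra.
    - unfold q. apply pow_incr. split; [lra|].
      assert (3 / 4 <= s) by apply Rmax_r. nra. }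
  set (B := 2 * M ^ 2 + 2 * C2 ^ 2).
  replace (INR n * (2 * M ^ 2 + 2 * e ^ 2) / INR (4 ^ k))
    with (INR n / INR (4 ^ k) * (2 * M ^ 2 + 2 * e ^ 2)) by (unfold Rdiv; ring).
  assert (H0 : 0 <= e ^ 2) by apply pow2_ge_0.
  assert (Hqp : 0 <= q) by (unfold q; apply pow_le; apply pow2_ge_0).
  assert (INR n / INR (4 ^ k) * (2 * M ^ 2 + 2 * e ^ 2) <= q * B).
  { apply Rle_trans with (q * (2 * M ^ 2 + 2 * e ^ 2)).
    - apply Rmult_le_compat_r; lra.
    - apply Rmult_le_compat_l; [easy|]. unfold B. lra. }
  lra.
Qed.

(** * Weights dominated by powers of [1 - |phi|^2] *)

Lemma rsum_inv_sq_le n : rsum (fun i => / (INR i + 1) ^ 2) n <= 2.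
Proof.
  assert (H : forall n, rsum (fun i => / (INR i + 1) ^ 2) (S n) <= 2 - / (INR n + 1)).
  { clear n. induction n as [|n IH].
    - simpl. lra.
    - change (rsum (fun i => / (INR i + 1) ^ 2) (S (S n)))
        with (rsum (fun i => / (INR i + 1) ^ 2) (S n) + / (INR (S n) + 1) ^ 2).
      rewrite S_INR. set (x := INR n) in *. assert (Hx : 0 <= x) by apply pos_INR.
      assert (/ (x + 1 + 1) ^ 2 <= / (x + 1) - / (x + 1 + 1)).
      { replace (/ (x + 1) - / (x + 1 + 1)) with (/ ((x + 1) * (x + 1 + 1))) by (field; lra).
        apply Rinv_le_contravar; nra. }
      lra. }
  destruct n as [|n]; [simpl; lra|]. specialize (H n).
  assert (0 < / (INR n + 1)) by (apply Rinv_0_lt_compat; assert (H1 := pos_INR n); lra). lra.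
Qed.

Lemma exists_pow4_bracket m n :
  (1 <= m)%nat -> (m <= n)%nat -> exists k, (m * 4 ^ k <= n < m * 4 ^ S k)%nat.
Proof.
  intros Hm. induction n as [|n IH]; intros Hn; [lia|].
  destruct (Nat.eq_dec m (S n)) as [E|Hne].
  - exists 0%nat. simpl. lia.
  - destruct IH as [k Hk]; [lia|].
    destruct (Nat.eq_dec (S n) (m * 4 ^ S k)) as [E|Hne'].
    + exists (S k). rewrite E. split; [lia|].
      rewrite (Nat.pow_succ_r' 4 (S k)). lia.
    + exists k. lia.
Qed.

Lemma pow_antimono y n m : 0 <= y <= 1 -> (n <= m)%nat -> y ^ m <= y ^ n.
Proof.
  intros Hy Hnm. replace m with (n + (m - n))%nat by lia. rewrite pow_add.
  rewrite <- Rmult_1_r. apply Rmult_le_compat_l; [apply pow_le; lra|].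
  rewrite <- (pow1 (m - n)). apply pow_incr. lra.
Qed.

(** If [m 4^k <= n < m 4^(k+1)], then [G^m y^n <= (G y^(4^k))^m <= s^(k m) <= 16^(-k)], while
    [(n+1)^2 <= 16 m^2 16^k]. Thus [1/16 = 4^(-2)] is exactly what turns geometric decay along
    powers of 4 into decay of order [n^(-2)]. For [n < m] the bound [n + 1 <= m] is enough. *)
Lemma weight_decay G y s m n :
  0 <= G <= 1 -> 0 <= y <= 1 -> 0 < s -> (1 <= m)%nat -> s ^ m <= / 16 ->
  (forall k, G * y ^ (4 ^ k) <= s ^ k) ->
  G ^ m * y ^ n <= 16 * INR m ^ 2 * / (INR n + 1) ^ 2.
Proof.
  intros HG Hy Hs Hm Hsm HGy.
  assert (Hn1 : 0 < (INR n + 1) ^ 2) by (apply pow_lt; assert (H := pos_INR n); lra).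
  apply Rmult_le_reg_r with ((INR n + 1) ^ 2); [easy|].
  rewrite Rmult_assoc with (r2 := / _), Rinv_l, Rmult_1_r by lra.
  assert (HGm : 0 <= G ^ m) by (apply pow_le; lra).
  assert (Hyn : 0 <= y ^ n) by (apply pow_le; lra).
  assert (Hm1 : 1 <= INR m) by (apply (le_INR 1); easy).
  destruct (Nat.lt_ge_cases n m) as [H|H].
  - assert (H1 : (INR n + 1) ^ 2 <= INR m ^ 2).
    { apply pow_incr. split; [assert (H0 := pos_INR n); lra|].
      rewrite <- S_INR. apply le_INR. lia. }
    assert (G ^ m <= 1) by (rewrite <- (pow1 m); apply pow_incr; lra).
    assert (y ^ n <= 1) by (rewrite <- (pow1 n); apply pow_incr; lra).
    assert (G ^ m * y ^ n <= 1) by nra. nra.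
  - destruct (exists_pow4_bracket m n Hm H) as [k [Hk1 Hk2]].
    assert (H1 : G ^ m * y ^ n <= (/ 16) ^ k).
    { apply Rle_trans with (G ^ m * y ^ (m * 4 ^ k)).
      - apply Rmult_le_compat_l; [easy|]. now apply pow_antimono.
      - rewrite Nat.mul_comm, pow_mult, <- Rpow_mult_distr.
        apply Rle_trans with ((s ^ k) ^ m).
        + apply pow_incr. split; [|apply HGy].
          apply Rmult_le_pos; [lra|apply pow_le; lra].
        + rewrite <- pow_mult, Nat.mul_comm, pow_mult. apply pow_incr.
          split; [apply pow_le; lra|easy]. }
    assert (H2 : (INR n + 1) ^ 2 <= 16 * INR m ^ 2 * 16 ^ k).
    { apply Rle_trans with ((INR m * (4 * 4 ^ k)) ^ 2).
      - apply pow_incr. split; [assert (H0 := pos_INR n); lra|].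
        rewrite <- S_INR. replace (INR m * (4 * 4 ^ k)) with (INR (m * 4 ^ S k)).
        + apply le_INR. lia.
        + rewrite mult_INR, pow_INR. replace (INR 4) with 4 by (simpl; lra). simpl. ring.
      - right. rewrite !Rpow_mult_distr. replace 16 with (4 ^ 2) at 2 by ring.
        rewrite <- !pow_mult, Nat.mul_comm. ring. }
    apply Rle_trans with ((/ 16) ^ k * (16 * INR m ^ 2 * 16 ^ k)).
    + apply Rmult_le_compat; try easy; try lra. apply Rmult_le_pos; easy.
    + right. rewrite pow_inv. field. apply pow_nonzero. lra.
Qed.

(** Summing the decay over [n] turns the left side into a geometric series; the factor 2 bounds the
    sum of [1/(n+1)^2]. *)
Lemma weight_geom_le G y D :
  0 <= G -> 0 <= y < 1 -> (forall n, G * y ^ n <= D * / (INR n + 1) ^ 2) -> 0 <= D ->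
  G * / (1 - y) <= 2 * D.
Proof.
  intros HG Hy H HD.
  apply (is_lim_seq_le_const (fun N => G * rsum (fun i => y ^ i) N)).
  - apply (is_lim_seq_scal_l _ G (/ (1 - y))).
    apply is_series_rsum. apply is_series_geom. rewrite Rabs_pos_eq; lra.
  - intros N. rewrite <- rsum_scal.
    apply Rle_trans with (rsum (fun i => D * / (INR i + 1) ^ 2) N).
    + apply rsum_le. intros; apply H.
    + rewrite rsum_scal. assert (H1 := rsum_inv_sq_le N). nra.
Qed.

Lemma Schatten_weight w phi p :
  analytic_selfmap phi -> 0 < p -> Schatten p (MwCphi w phi) ->
  exists hc h s, is_pseries_on_D hc h /\ (forall z, inD z -> h z <> 0%C) /\ 0 < s < 1 /\
    forall z, inD z -> Cmod (h z * w z)%C ^ 2 <= 1 /\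
      forall k, Cmod (h z * w z)%C ^ 2 * (Cmod (phi z) ^ 2) ^ (4 ^ k) <= s ^ k.
Proof.
  intros [_ Hphi] Hp HT.
  destruct (Schatten_monomial_decay p _ Hp HT) as [C0 [s [HC0 [Hs Hdec]]]].
  set (j := fun k => proj1_sig (constructive_indefinite_description _ (Hdec k))).
  assert (Hj : forall k, exists b, (j k < 4 ^ k)%nat /\
    is_H2_coeffs b (MwCphi w phi (fun z => z ^ j k)%C) /\ l2sum b <= C0 * (s ^ 2) ^ k)
    by (intros k; exact (proj2_sig (constructive_indefinite_description _ (Hdec k)))).
  set (b := fun k => proj1_sig (constructive_indefinite_description _ (Hj k))).
  assert (Hb : forall k, (j k < 4 ^ k)%nat /\
    is_H2_coeffs (b k) (MwCphi w phi (fun z => z ^ j k)%C) /\ l2sum (b k) <= C0 * (s ^ 2) ^ k)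
    by (intros k; exact (proj2_sig (constructive_indefinite_description _ (Hj k)))).
  clearbody j b. clear Hj Hdec.
  (* The squared norms decay like [s^(2k)]. Weighting by [s^(-k)] splits this: one factor [s^k]
     keeps the family summable, the other becomes the pointwise decay. *)
  set (be := fun k => sqrt (/ s ^ k)).
  assert (Hsk : forall k, 0 < s ^ k) by (intros; apply pow_lt; lra).
  assert (Hbe : forall k, Cmod (be k) ^ 2 = / s ^ k).
  { intros k. unfold be. rewrite Cmod_R, Rabs_pos_eq by apply sqrt_pos.
    rewrite pow2_sqrt; [easy|]. left. now apply Rinv_0_lt_compat. }
  destruct (outer_bound (fun k i => be k * b k i)%C (fun k => C0 * s ^ k) (C0 * / (1 - s)))
    as [hc [h [Hh [Hh0 Hhf]]]].
  - intros k n. destruct (Hb k) as [_ [[Hbe2 _] Hl]].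
    rewrite (rsum_ext _ (fun i => / s ^ k * Cmod (b k i) ^ 2))
      by (intros; now rewrite Cmod2_mult, Hbe).
    rewrite rsum_scal. apply Rle_trans with (/ s ^ k * (C0 * (s ^ 2) ^ k)).
    + apply Rmult_le_compat_l; [left; now apply Rinv_0_lt_compat|].
      eapply Rle_trans; [now apply l2sum_ge|easy].
    + right. rewrite <- pow_mult. replace (2 * k)%nat with (k + k)%nat by lia.
      rewrite pow_add. field. specialize (Hsk k). lra.
  - intros n. rewrite rsum_scal. apply Rmult_le_compat_l; [easy|]. apply rsum_geom_le. lra.
  - exists hc, h, s. split; [easy|]. split; [easy|]. split; [easy|]. intros z Hz.
    assert (Hy := Cmod2_lt_1 _ (Hphi z Hz)).
    assert (Hk : forall k, Cmod (h z * w z)%C ^ 2 * (Cmod (phi z) ^ 2) ^ j k <= s ^ k).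
    { intros k. destruct (Hb k) as [_ [[_ Hps] _]].
      assert (H := Hhf k _ z (pseries_scal (be k) _ _ Hps) Hz). cbv beta in H.
      unfold MwCphi in H.
      match type of H with Cmod ?x <= _ =>
        assert (H1 := pow_incr (Cmod x) 1 2 (conj (Cmod_ge_0 x) H)) end.
      clear H. rename H1 into H.
      rewrite !Cmod2_mult, Hbe in H. rewrite Cmod2_mult.
      replace (Cmod (phi z ^ j k)%C ^ 2) with ((Cmod (phi z) ^ 2) ^ j k) in H.
      2:{ rewrite Cmod_pow, <- !pow_mult. f_equal. lia. }
      specialize (Hsk k).
      apply Rmult_le_reg_l with (/ s ^ k); [now apply Rinv_0_lt_compat|].
      rewrite Rinv_l by lra. lra. }
    split.
    (* At [k = 0] the constraint [j < 4^0] forces [j = 0], and the estimate is the plain bound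
       [|h w| <= 1]. *)
    + assert (H := Hk 0%nat). destruct (Hb 0%nat) as [H0 _].
      replace (j 0%nat) with 0%nat in H by (simpl in H0; lia). simpl pow in H. simpl pow. lra.
    + intros k. eapply Rle_trans; [|apply Hk].
      apply Rmult_le_compat_l; [apply Cmod2_nonneg|].
      apply pow_antimono; [lra|]. destruct (Hb k) as [H0 _]. lia.
Qed.

(** Operators act on functions, so a truncation of the Taylor series needs coefficients recovered
    from the function alone; they are chosen, and are unique for a function in the Hardy space. *)
Definition taylor (f : C -> C) : nat -> C :=
  epsilon (inhabits (fun _ : nat => RtoC 0)) (fun a => is_H2_coeffs a f).

Lemma taylor_spec f : H2 f -> is_H2_coeffs (taylor f) f.
Proof. intros H. unfold taylor. now apply epsilon_spec. Qed.

Lemma taylor_unique a f : is_H2_coeffs a f -> forall n, taylor f n = a n.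
Proof.
  intros Ha. apply (pseries_coeffs_unique _ _ f f); [|apply Ha|easy].
  apply taylor_spec. now exists a.
Qed.

Lemma rpow_2_le x e : 0 <= e -> x <= e -> rpow x 2 <= e ^ 2.
Proof.
  intros He Hx. unfold rpow. destruct (Rle_dec x 0) as [H|H]; [apply pow2_ge_0|].
  replace 2 with (INR 2) at 1 by (simpl; lra). rewrite Rpower_pow by lra.
  apply pow_incr. lra.
Qed.

Lemma MwCphi_linear w phi : linear_H2 (MwCphi w phi).
Proof. split; intros; unfold MwCphi; ring. Qed.

(** * A pointwise criterion for Hilbert-Schmidt weighted composition operators *)

Section WeightedComposition.

Variables (w phi V : C -> C) (vc : nat -> C) (D : R).
Hypothesis Hphi : analytic_selfmap phi.
Hypothesis Hw : bounded_H2 (MwCphi w phi).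
Hypothesis HV : is_pseries_on_D vc V.

Let W (z : C) : C := (V z * w z)%C.

Hypothesis HD : 0 <= D.
(** The factor [|phi|^(2n) / (1 - |phi|^2)] is the squared norm of the functional sending [f] to the
    value at [phi z] of its Taylor tail from degree [n] on. *)
Hypothesis HW : forall z n, inD z ->
  Cmod (W z) ^ 2 * ((Cmod (phi z) ^ 2) ^ n * / (1 - Cmod (phi z) ^ 2))
  <= D * / (INR n + 1) ^ 2.

(** Boundedness of the operator with weight [w] supplies a power series for [w] times the tail
    composed with [phi], and multiplication by [V] keeps it a power series. Its supremum on the disk
    is controlled by [HW], and a supremum bound is a bound of the Hardy norm. *)
Lemma weighted_tail a f n :
  is_H2_coeffs a f ->
  exists b,
    is_H2_coeffs b (fun z => W z * (f (phi z) - csum (fun k => a k * phi z ^ k) n))%C /\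
    l2sum b <= D * / (INR n + 1) ^ 2 * l2sum a.
Proof.
  intros Ha. destruct Hw as [M HM].
  assert (Hn := H2_coeffs_lincomb a cdelta (fun k z => z ^ k)%C n
                  (fun i _ => H2_coeffs_monomial i)).
  destruct (HM _ _ (H2_coeffs_minus _ _ _ _ Ha Hn)) as [b0 [[_ Hb0] _]].
  set (g := fun z => (W z * (f (phi z) - csum (fun k => a k * phi z ^ k) n))%C).
  assert (Hg : is_pseries_on_D (conv vc b0) g).
  { apply (pseries_ext _ _ _ _ (fun _ => eq_refl)) with (2 := pseries_mult vc b0 V _ HV Hb0).
    intros z _. unfold g, W, MwCphi. cbv beta. rewrite lincomb_csum. ring. }
  set (q := D * / (INR n + 1) ^ 2 * l2sum a).
  assert (Hl : forall K, rsum (fun k => Cmod (conv vc b0 k) ^ 2) K <= q).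
  { assert (q0 : 0 <= q).
    { unfold q. apply Rmult_le_pos; [|apply l2sum_nonneg, Ha].
      apply Rmult_le_pos; [easy|]. left. apply Rinv_0_lt_compat, pow_lt.
      assert (H := pos_INR n). lra. }
    intros K. rewrite <- (pow2_sqrt q q0).
    apply (pseries_bounded_coeffs _ g (sqrt q) K Hg).
    intros z Hz. apply Rsqr_incr_0_var; [|apply sqrt_pos].
    rewrite !Rsqr_pow2, pow2_sqrt by easy. unfold g. rewrite Cmod2_mult.
    apply Rle_trans with (Cmod (W z) ^ 2 *
      (l2sum a * ((Cmod (phi z) ^ 2) ^ n * / (1 - Cmod (phi z) ^ 2)))).
    - apply Rmult_le_compat_l; [apply Cmod2_nonneg|].
      apply pseries_tail_bound; [apply Ha| |now apply Hphi].
      intros m. apply l2sum_ge, Ha.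
    - unfold q.
      assert (H1 := HW z n Hz). assert (H2 := l2sum_nonneg a (proj1 Ha)).
      assert (H3 := Rmult_le_compat_r _ _ _ H2 H1). lra. }
  exists (conv vc b0). split; [split|].
  - now apply l2_ex_series with q.
  - exact Hg.
  - now apply l2sum_le.
Qed.

Lemma weighted_bounded a f :
  is_H2_coeffs a f ->
  exists b, is_H2_coeffs b (MwCphi W phi f) /\ l2sum b <= sqrt D ^ 2 * l2sum a.
Proof.
  intros Ha. destruct (weighted_tail a f 0 Ha) as [b [Hb Hl]]. exists b. split.
  - apply (H2_coeffs_ext b b _ _ (fun _ => eq_refl)) with (2 := Hb).
    intros z _. unfold MwCphi. simpl csum. ring.
  - rewrite pow2_sqrt by easy. simpl INR in Hl.
    replace (D * / (0 + 1) ^ 2) with D in Hl by field. easy.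
Qed.

(** The operator with weight [W] preceded by the orthogonal projection onto polynomials of degree
    below [n]. *)
Definition truncated_op (n : nat) : op :=
  fun f z => (W z * csum (fun k => taylor f k * phi z ^ k) n)%C.

Lemma truncated_op_rank n : rank_le_H2 (truncated_op n) n.
Proof.
  split; [|split].
  - split.
    + intros f g Hf Hg z Hz. apply taylor_spec in Hf, Hg. unfold truncated_op.
      rewrite <- Cmult_plus_distr_l, <- csum_plus. f_equal. apply csum_ext. intros k _.
      rewrite (taylor_unique _ _ (H2_coeffs_plus _ _ _ _ Hf Hg)). ring.
    + intros c f Hf z Hz. apply taylor_spec in Hf. unfold truncated_op.
      rewrite (csum_ext _ (fun k => c * (taylor f k * phi z ^ k))%C).
      * rewrite csum_scal. ring.
      * intros k _. rewrite (taylor_unique _ _ (H2_coeffs_scal c _ _ Hf)). ring.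
  - exists (sqrt D). intros a f Ha.
    assert (Hn := H2_coeffs_lincomb a cdelta (fun k z => z ^ k)%C n
                    (fun i _ => H2_coeffs_monomial i)).
    destruct (weighted_bounded _ _ Hn) as [b [Hb Hl]]. exists b. split.
    + apply (H2_coeffs_ext b b _ _ (fun _ => eq_refl)) with (2 := Hb).
      intros z _. unfold MwCphi, truncated_op. rewrite lincomb_csum. f_equal.
      apply csum_ext. intros. now rewrite (taylor_unique a).
    + eapply Rle_trans; [apply Hl|]. apply Rmult_le_compat_l; [apply pow2_ge_0|].
      apply l2sum_le. intros m. eapply Rle_trans; [apply rsum_truncated_le|].
      apply l2sum_ge, Ha.
  - exists (fun i => MwCphi W phi (fun z => z ^ i)%C). split.
    + intros i _. destruct (weighted_bounded _ _ (H2_coeffs_monomial i)) as [b [Hb _]].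
      now exists b.
    + intros f _. exists (taylor f). intros z _. rewrite lincomb_csum.
      unfold truncated_op, MwCphi. rewrite <- csum_scal. apply csum_ext. intros. ring.
Qed.

Lemma truncated_op_approx n :
  opnorm_diff_le (MwCphi W phi) (truncated_op n) (sqrt D * / (INR n + 1)).
Proof.
  intros a f b c Ha Hb Hc. destruct (weighted_tail a f n Ha) as [b' [Hb' Hl]].
  rewrite Rpow_mult_distr, pow2_sqrt, pow_inv by easy.
  eapply Rle_trans; [|apply Hl]. right. apply l2sum_ext.
  apply (pseries_coeffs_unique _ _ _ _
    (pseries_minus _ _ _ _ (proj2 Hb) (proj2 Hc)) (proj2 Hb')).
  intros z _. unfold MwCphi, truncated_op.
  rewrite (csum_ext (fun k => taylor f k * phi z ^ k)%C (fun k => a k * phi z ^ k)%C)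
    by (intros; now rewrite (taylor_unique a)).
  ring.
Qed.

(** The truncation of rank [n] shows that the squared [n]-th approximation number is at most
    [D / (n+1)^2], which is summable. *)
Lemma weighted_HilbertSchmidt : HilbertSchmidt (MwCphi W phi).
Proof.
  split; [apply MwCphi_linear|]. split; [exists (sqrt D); apply weighted_bounded|].
  apply rsum_bounded_ex_series with (D * 2); [intros; apply rpow_nonneg|].
  intros N. apply Rle_trans with (rsum (fun n => D * / (INR n + 1) ^ 2) N).
  - apply rsum_le. intros n _.
    assert (Hn : 0 < / (INR n + 1))
      by (apply Rinv_0_lt_compat; assert (H := pos_INR n); lra).
    replace (D * / (INR n + 1) ^ 2) with ((sqrt D * / (INR n + 1)) ^ 2)
      by now rewrite Rpow_mult_distr, pow2_sqrt, pow_inv.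
    assert (H0 : 0 <= sqrt D * / (INR n + 1))
      by (apply Rmult_le_pos; [apply sqrt_pos|lra]).
    apply rpow_2_le; [easy|].
    apply sing_num_le with (truncated_op n);
      [easy|apply truncated_op_rank|apply truncated_op_approx].
  - rewrite rsum_scal. apply Rmult_le_compat_l; [easy|apply rsum_inv_sq_le].
Qed.

End WeightedComposition.

Theorem theorem4p5 (phi : C -> C) (p : R) :
  analytic_selfmap phi -> 0 < p ->
  (exists w : C -> C, H2 w /\ (exists z, inD z /\ w z <> 0%C) /\
     bounded_H2 (MwCphi w phi) /\ Schatten p (MwCphi w phi)) ->
  exists wt : C -> C, H2 wt /\ (exists z, inD z /\ wt z <> 0%C) /\
     bounded_H2 (MwCphi wt phi) /\ HilbertSchmidt (MwCphi wt phi).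
Proof.
  intros Hphi Hp [w [[wc [_ Hwc]] [[z0 [Hz0 Hwz0]] [Hb HT]]]].
  destruct (Schatten_weight w phi p Hphi Hp HT) as [hc [h [s [Hh [Hh0 [Hs Hg]]]]]].
  destruct (pow_lt_1_zero s ltac:(rewrite Rabs_pos_eq; lra) (/ 16) ltac:(lra)) as [N HN].
  set (m := S N).
  assert (Hm : s ^ m <= / 16).
  { specialize (HN m ltac:(unfold m; lia)). rewrite Rabs_pos_eq in HN; [lra|].
    apply pow_le; lra. }
  set (g := fun z => (h z * w z)%C).
  assert (Hgp : is_pseries_on_D (conv hc wc) g) by now apply pseries_mult.
  (* As [m = N + 1], this is [2m - 1]: the weight [g^(2m)] is factored as [V w] with a single [w]
     split off, so that the bounded operator with weight [w] can be used. *)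
  set (q := (m + N)%nat).
  destruct (pseries_pow _ _ q Hgp) as [gc Hgc].
  set (V := fun z => (h z * g z ^ q)%C).
  set (wt := fun z => (V z * w z)%C).
  assert (Ewt : forall z, wt z = (g z ^ m * g z ^ m)%C).
  { intros z. rewrite <- Cpow_add_r. replace (m + m)%nat with (S q) by (unfold q, m; lia).
    rewrite Cpow_S. unfold wt, V, g at 2. ring. }
  set (D0 := 16 * INR m ^ 2).
  assert (HD0 : 0 <= D0) by (unfold D0; assert (H := pow2_ge_0 (INR m)); lra).
  assert (HG : forall z, inD z -> 0 <= Cmod (g z) ^ 2 <= 1)
    by (intros z Hz; split; [apply Cmod2_nonneg|now apply Hg]).
  assert (Edec : forall z n, inD z ->
    (Cmod (g z) ^ 2) ^ m * (Cmod (phi z) ^ 2) ^ n <= D0 * / (INR n + 1) ^ 2).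
  { intros z n Hz. assert (Hy := Cmod2_lt_1 _ (proj2 Hphi z Hz)).
    apply (weight_decay _ _ s); try easy; try lra; [now apply HG|unfold m; lia|].
    now apply Hg. }
  assert (HW : forall z n, inD z ->
    Cmod (wt z) ^ 2 * ((Cmod (phi z) ^ 2) ^ n * / (1 - Cmod (phi z) ^ 2))
    <= (2 * D0 * D0) * / (INR n + 1) ^ 2).
  { intros z n Hz. assert (Hy := Cmod2_lt_1 _ (proj2 Hphi z Hz)).
    rewrite Ewt, Cmod2_mult, Cmod_pow, <- pow_mult, Nat.mul_comm, pow_mult.
    assert (HGm : 0 <= (Cmod (g z) ^ 2) ^ m) by (apply pow_le; now apply HG).
    assert (H1 := weight_geom_le _ _ D0 HGm Hy (fun n => Edec z n Hz) HD0).
    assert (H2 := Edec z n Hz).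
    assert (H3 : 0 <= (Cmod (g z) ^ 2) ^ m * (Cmod (phi z) ^ 2) ^ n)
      by (apply Rmult_le_pos; [easy|apply pow_le; lra]).
    assert (H4 : 0 <= (Cmod (g z) ^ 2) ^ m * / (1 - Cmod (phi z) ^ 2))
      by (apply Rmult_le_pos; [easy|left; apply Rinv_0_lt_compat; lra]).
    (* The two copies of [|g|^(2m)] contribute [D0 / (n+1)^2] and [2 D0], whence the constant
       [2 D0 D0]. *)
    assert (H5 := Rmult_le_compat _ _ _ _ H3 H4 H2 H1). lra. }
  assert (HVp : is_pseries_on_D (conv hc gc) V) by now apply pseries_mult.
  assert (HD : 0 <= 2 * D0 * D0) by nra.
  exists wt. split; [|split; [|split]].
  - exists (conv (conv hc gc) wc). split; [|now apply pseries_mult].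
    apply l2_ex_series with (1 ^ 2). intros n.
    apply (pseries_bounded_coeffs _ wt); [now apply pseries_mult|].
    intros z Hz. rewrite Ewt, Cmod_mult, Cmod_pow.
    assert (0 <= Cmod (g z) ^ m <= 1).
    { split; [apply pow_le, Cmod_ge_0|]. rewrite <- (pow1 m). apply pow_incr.
      assert (H0 := Cmod_ge_0 (g z)). assert (H := HG z Hz). split; [easy|nra]. }
    nra.
  - exists z0. split; [easy|]. rewrite Ewt.
    assert (g z0 <> 0%C) by (apply Cmult_neq_0; auto).
    apply Cmult_neq_0; now apply Cpow_nz.
  - exists (sqrt (2 * D0 * D0)). intros a f.
    apply (weighted_bounded w phi V (conv hc gc)); easy.
  - apply (weighted_HilbertSchmidt w phi V (conv hc gc) (2 * D0 * D0)); easy.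
Qed.
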